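(* For any two abstract merge trees $T_1,\ell_1$ and $T_2,\ell_2$, the one-degree edit distance is exactly the cost of an optimal path mapping between $T_1$ and $T_2$: $$\delta_1(T_1,T_2)=\min\{\mathrm c(M)\mid M\text{ is a path mapping between }T_1\text{ and }T_2\}.$$
   Context: Rooted trees $T$ are finite directed graphs whose edges point from child to parent: $(c,p)\in E(T)$ means that $c$ is a child of $p$. $\deg_T(p)$ is the number of children of $p$. A leaf is a node without children. An abstract merge tree is an unordered rooted tree $T$ with edge labels $\ell:E(T)\to\mathbb R_{>0}$ such that $\deg_T(\mathrm{root}(T))=1$ and $\deg_T(v)\neq 1$ for all $v\neq\mathrm{root}(T)$. Abstract merge trees are considered up to isomorphism of rooted edge-labeled trees. One-degree edit operations. Each transforms an abstract merge tree $T,\ell$ into another one $T',\ell'$: (1) Relabel: change the label of one edge $e$ to a new value in $\mathbb R_{>0}$, at cost $|\ell(e)-\ell'(e)|$. (2) Deletion of an edge $(c,p)$, where $c$ is a leaf and $p$ is not the root: remove $c$ and $(c,p)$. If $p$ is then left with exactly one child $c'$, also remove $p$ and, with $p'$ the parent of $p$, replace $(c',p),(p,p')$ by the edge $(c',p')$ with label $\ell((c',p))+\ell((p,p'))$. All other labels are unchanged. The cost is $\ell((c,p))$. (3) Insertion: the inverse of a deletion of type (2), with the same cost. A one-degree edit sequence is a finite sequence $S$ of such operations. $\mathrm c(S)$ is the sum of their costs, and $T_1\xrightarrow{S}T_2$ means that $S$ transforms $T_1$ into $T_2$. Then $\delta_1(T_1,T_2)=\inf\{\mathrm c(S)\mid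 T_1\xrightarrow{S}T_2,\ S\text{ a one-degree edit sequence}\}$. Paths. A path in $T$ is a sequence of vertices $p=v_1\dots v_k$, $k\ge 2$, with $(v_i,v_{i-1})\in E(T)$ for $2\le i\le k$ (directed away from the root). $\mathrm{start}(p)=v_1$, $\mathrm{end}(p)=v_k$, $\ell(p)=\sum_{i=2}^k\ell((v_i,v_{i-1}))$, and $\mathcal P(T)$ is the set of all paths. Path mappings. A path mapping between $T_1$ and $T_2$ is a set $M\subseteq\mathcal P(T_1)\times\mathcal P(T_2)$ such that 1. for all $(p_1,q_1),(p_2,q_2)\in M$: $p_1=p_2$ if and only if $q_1=q_2$; 2. for all distinct $(p_1,q_1),(p_2,q_2)\in M$: $|p_1\cap p_2|\le 1$ and $|q_1\cap q_2|\le 1$ (intersections of vertex sets); 3. for all $(p,q)\in M$: either there is $(p',q')\in M$ with $\mathrm{start}(p)=\mathrm{end}(p')$ and $\mathrm{start}(q)=\mathrm{end}(q')$, or $\mathrm{start}(p)=\mathrm{root}(T_1)$ and $\mathrm{start}(q)=\mathrm{root}(T_2)$. Its cost is $$\mathrm c(M)=\sum_{(p,q)\in M}|\ell_1(p)-\ell_2(q)|+\sum_{e\in D_1}\ell_1(e)+\sum_{e\in D_2}\ell_2(e),$$ where $D_1\subseteq E(T_1)$ (respectively $D_2\subseteq E(T_2)$) is the set of edges not lying on any path $p$ (respectively $q$) with $(p,q)\in M$. *)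

(* Defs.v *)
From mathcomp Require Import all_boot all_order all_algebra.
From mathcomp Require Import finmap.
From mathcomp Require Import classical_sets reals ereal.

Set Implicit Arguments.
Unset Strict Implicit.
Unset Printing Implicit Defensive.

Import Order.TTheory GRing.Theory Num.Theory.

Local Open Scope ring_scope.

Section Trees.
Variable R : realType.

(* [edge c p] is the directed edge from the child [c] to the parent [p]. *)
Definition rooted_tree (V : finType) (edge : rel V) (r : V) : Prop :=
  [/\ forall p, ~~ edge r p,
      forall v, v != r -> exists! p, edge v p &
      forall v, connect edge v r].

Definition children (V : finType) (edge : rel V) (p : V) : {set V} :=
  [set c | edge c p]%SET.

(* The label function is total; only its values on edges are meaningful. *)
Record merge_tree := MergeTree {
  vertex :> finType;
  edge : rel vertex;
  troot : vertex;
  label : vertex * vertex -> R;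
  edge_tree : rooted_tree edge troot;
  deg_root : #|children edge troot| = 1%N;
  deg_nonroot : forall v, v != troot -> #|children edge v| <> 1%N;
  label_gt0 : forall c p, edge c p -> 0 < label (c, p) }.

Definition deg (T : merge_tree) (v : T) : nat := #|children (@edge T) v|.

Definition leaf (T : merge_tree) (v : T) : Prop := deg v = 0%N.

(* [T] is isomorphic to the labeled graph with vertex set [A], root [r], edge
   relation [E] restricted to [A], and labels [l] on these edges. *)
Definition iso_to (T : merge_tree) (V : finType) (A : {set V}) (E : rel V)
    (r : V) (l : V * V -> R) : Prop :=
  exists f : T -> V,
    [/\ injective f, [set f x | x : T]%SET = A, f (troot T) = r,
        forall x y, edge x y = E (f x) (f y) &
        forall x y, edge x y -> label (x, y) = l (f x, f y)].

Definition isomorphic (T T' : merge_tree) : Prop :=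
  iso_to T' [set: T]%SET (@edge T) (troot T) (@label T).

Definition relabeling (T : merge_tree) (c p : T) (v : R) (T' : merge_tree) :
    Prop :=
  [/\ edge c p, 0 < v &
      iso_to T' [set: T]%SET (@edge T) (troot T)
        (fun e => if e == (c, p) then v else label e)].

Definition deletion (T : merge_tree) (c p : T) (T' : merge_tree) : Prop :=
  [/\ edge c p, leaf c, p != troot T &
      (#|children (@edge T) p :\ c| <> 1%N /\
         iso_to T' [set~ c]%SET (@edge T) (troot T) (@label T))
      \/ (exists c' p' : T,
         [/\ (children (@edge T) p :\ c)%SET = [set c']%SET, edge p p' &
             iso_to T' (~: [set c; p])%SET
               (fun x y => edge x y || ((x, y) == (c', p'))) (troot T)
               (fun e => if e == (c', p') then label (c', p) + label (p, p')
                         else label e)])].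

Inductive edit_op (T T' : merge_tree) : Type :=
| Relabel (c p : T) (v : R) of relabeling c p v T'
| Delete (c p : T) of deletion c p T'
| Insert (c p : T') of deletion c p T.

Definition op_cost (T T' : merge_tree) (o : edit_op T T') : R :=
  match o with
  | Relabel c p v _ => `|label (c, p) - v|
  | Delete c p _ => label (c, p)
  | Insert c p _ => label (c, p)
  end.

(* [edit_sequence T2 T1] is the type of sequences from [T1] to [T2]. Trees are
   considered up to isomorphism, hence the empty sequence relates isomorphic
   trees. *)
Inductive edit_sequence (T2 : merge_tree) : merge_tree -> Type :=
| EditNil (T1 : merge_tree) of isomorphic T1 T2 : edit_sequence T2 T1
| EditCons (T1 T : merge_tree) of edit_op T1 T & edit_sequence T2 T :
    edit_sequence T2 T1.

Fixpoint seq_cost (T2 T1 : merge_tree) (S : edit_sequence T2 T1) : R :=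
  match S with
  | EditNil _ _ => 0
  | EditCons _ _ o S' => op_cost o + seq_cost S'
  end.

Definition delta1 (T1 T2 : merge_tree) : \bar R :=
  ereal_inf [set x | exists S : edit_sequence T2 T1, x = (seq_cost S)%:E]%classic.

Definition is_path (T : merge_tree) (p : seq T) : bool :=
  (1 < size p)%N && sorted (fun x y => edge y x) p.

(* The default value is irrelevant, as paths are nonempty. *)
Definition path_start (T : merge_tree) (p : seq T) : T := head (troot T) p.
Definition path_end (T : merge_tree) (p : seq T) : T := last (troot T) p.

(* The pairs (v_i, v_(i-1)) for p = v_1 ... v_k and 2 <= i <= k. *)
Definition path_edges (T : merge_tree) (p : seq T) : seq (T * T) :=
  zip (behead p) p.

Definition path_label (T : merge_tree) (p : seq T) : R :=
  \sum_(e <- path_edges p) label e.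

Definition path_meet (T : merge_tree) (p q : seq T) : {set T} :=
  [set x | (x \in p) && (x \in q)]%SET.

Section PathMappings.
Variables T1 T2 : merge_tree.

(* A tree has finitely many paths, so finite sets of pairs lose no generality. *)
Definition path_mapping (M : {fset seq T1 * seq T2}) : Prop :=
  [/\ forall p q, (p, q) \in M -> is_path p /\ is_path q,
      forall p1 q1 p2 q2, (p1, q1) \in M -> (p2, q2) \in M ->
        (p1 = p2 <-> q1 = q2),
      forall p1 q1 p2 q2, (p1, q1) \in M -> (p2, q2) \in M ->
        (p1, q1) <> (p2, q2) ->
        (#|path_meet p1 p2| <= 1)%N /\ (#|path_meet q1 q2| <= 1)%N &
      forall p q, (p, q) \in M ->
        (exists p' q', [/\ (p', q') \in M, path_start p = path_end p' &
                           path_start q = path_end q'])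
        \/ (path_start p = troot T1 /\ path_start q = troot T2)].

Definition unmapped1 (M : {fset seq T1 * seq T2}) : {set T1 * T1} :=
  [set e | edge e.1 e.2 & all (fun pq => e \notin path_edges pq.1) M]%SET.

Definition unmapped2 (M : {fset seq T1 * seq T2}) : {set T2 * T2} :=
  [set e | edge e.1 e.2 & all (fun pq => e \notin path_edges pq.2) M]%SET.

Definition mapping_cost (M : {fset seq T1 * seq T2}) : R :=
  \sum_(pq <- M) `|path_label pq.1 - path_label pq.2|
  + \sum_(e in unmapped1 M) label e + \sum_(e in unmapped2 M) label e.

End PathMappings.
End Trees.

(* Main.v *)
(** Identify the edge above a non-root vertex [x] with [x].  A path mapping then
    assigns to each vertex of either tree the pair of paths covering its edge,
    or nothing if that edge is unmapped.  Call such assignments colorings: they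
    are partial maps to a rooted tree of colors, characterised by essentially
    local conditions, so that editing a tree changes them locally.

    Lower bound: pull a matching of colorings back along an edit operation.  If
    [T'] arises from [T] by deleting an edge, mapping each edge of [T] to the
    edge of [T'] containing it is itself a coloring of [T] by the vertices of
    [T'], and colorings compose.  For an insertion, the coloring has to be
    constant on the two edges that get merged; extending a path by an unmapped
    edge, or concatenating two consecutive paths (in both trees), achieves this
    and does not increase the cost, by the triangle inequality.

    Upper bound: unmapped edges are closed downwards, so some unmapped edge ends
    in a leaf; delete it and transport the matching as above.  When every edge
    of both trees is mapped, the absence of vertices of degree one forces all
    paths to be single edges: the trees are isomorphic up to labels, and
    relabeling finishes the sequence. *)
Require Import Defs.
From mathcomp Require Import all_boot all_order all_algebra.
From mathcomp Require Import finmap.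
From mathcomp Require Import boolp classical_sets reals ereal.
From mathcomp Require Import lra.

Set Implicit Arguments.
Unset Strict Implicit.
Unset Printing Implicit Defensive.

Import Order.TTheory GRing.Theory Num.Theory.

Local Open Scope ring_scope.

(** * The parent function *)

Section ParentFunction.
Variables (R : realType) (T : merge_tree R).
Implicit Types x y z : T.

Definition par x : T := odflt (troot T) [pick p | edge x p].

Lemma edgeE x y : edge x y = (x != troot T) && (y == par x).
Proof.
have [Hr Hu _] := edge_tree T; rewrite /par.
case: eqVneq => [->|xr] /=; first exact: negbTE (Hr y).
have [p [xp pu]] := Hu x xr.
case: pickP => [q xq|/(_ p)]; last by rewrite xp.
by rewrite /= -(pu _ xq); apply/idP/eqP => [/pu //|->].
Qed.

Lemma edge_par x : x != troot T -> edge x (par x).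
Proof. by rewrite edgeE => -> /=. Qed.

Lemma par_root : par (troot T) = troot T.
Proof.
have [Hr _ _] := edge_tree T; rewrite /par.
by case: pickP => [p|//]; rewrite (negbTE (Hr p)).
Qed.

Lemma iter_par_root x : exists n, iter n par x == troot T.
Proof.
have [_ _ /(_ x)/connectP[s]] := edge_tree T.
elim: s x => [|y s IHs] x /=; first by move=> _ ->; exists 0%N.
case/andP; rewrite edgeE => /andP[_ /eqP->] /IHs/[apply] -[n nP].
by exists n.+1; rewrite iterSr.
Qed.

Definition depth x : nat := ex_minn (iter_par_root x).

Lemma depth_par x : x != troot T -> depth x = (depth (par x)).+1.
Proof.
move=> xr; rewrite /depth; case: ex_minnP => -[|n] nP nmin.
  by rewrite /= (negbTE xr) in nP.
case: ex_minnP => m mP mmin; congr _.+1; apply/eqP; rewrite eqn_leq.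
by rewrite mmin -?iterSr // andbT -ltnS nmin // iterSr.
Qed.

Lemma par_neq x : x != troot T -> par x != x.
Proof. by move=> /depth_par dx; apply/eqP => px; rewrite px in dx; exact: n_Sn dx. Qed.

(** Induction from the root downwards; nothing may be assumed at the root, so base case and step are
    proved at once. *)
Lemma depth_ind (P : T -> Prop) :
  (forall x, (x != troot T -> P (par x)) -> P x) -> forall x, P x.
Proof.
move=> IH x; have [n] := ubnP (depth x); elim: n x => // n IHn x dx.
by apply: IH => xr; apply: IHn; rewrite -ltnS -depth_par.
Qed.

(** The label of the edge above [x] is moved to [x] itself; the value 0 at the root lets sums run
    over all vertices. *)
Definition wt x : R := if x == troot T then 0 else label (x, par x).

Lemma wt_root : wt (troot T) = 0.
Proof. by rewrite /wt eqxx. Qed.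

Lemma label_wt x y : edge x y -> label (x, y) = wt x.
Proof. by rewrite edgeE /wt => /andP[/negbTE-> /eqP->]. Qed.

Lemma wt_gt0 x : x != troot T -> 0 < wt x.
Proof. by move=> xr; rewrite -(label_wt (edge_par xr)) label_gt0 ?edge_par. Qed.

Lemma wt_ge0 x : 0 <= wt x.
Proof.
by have [->|/wt_gt0/ltW//] := eqVneq x (troot T); rewrite wt_root.
Qed.

Lemma root_childP :
  exists2 a, a != troot T & forall x, x != troot T -> par x = troot T -> x = a.
Proof.
have /eqP/cards1P[a aP] := deg_root T.
have := set11 a; rewrite -aP inE edgeE => /andP[ar _].
exists a => // x xr px; apply/set1P; rewrite -aP inE -px; exact: edge_par.
Qed.

(** The ban on inner vertices of degree one, in the form that later forces the paths of fully mapped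
    trees to be single edges. *)
Lemma siblingP x :
  x != troot T -> par x != troot T ->
  exists z, [/\ z != troot T, z != x & par z = par x].
Proof.
move=> xr /deg_nonroot; have cx : x \in children (@edge _ T) (par x).
  by rewrite inE edge_par.
rewrite (cardsD1 x) cx => n1.
have /card_gt0P[z] : (0 < #|children (@edge _ T) (par x) :\ x|)%N.
  by rewrite lt0n; apply/eqP => z0; rewrite z0 in n1.
by rewrite !inE edgeE => /and3P[zx zr /eqP pz]; exists z.
Qed.

End ParentFunction.

Section Cost.
Variable R : realType.

(** * Costs of pairs of colorings *)

Definition weight (V : finType) (I : eqType) (w : V -> R) (a : V -> option I)
  (i : option I) : R := \sum_(x | a x == i) w x.

(** The cost of a path mapping read off from colors: the weight of a color is the length of its
    path, and uncolored weight is the length of the unmapped edges. *)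
Definition ccost (V1 V2 I : finType) (w1 : V1 -> R) (a : V1 -> option I)
    (w2 : V2 -> R) (b : V2 -> option I) : R :=
  \sum_i `|weight w1 a (Some i) - weight w2 b (Some i)|
  + weight w1 a None + weight w2 b None.

Definition keep (I : Type) (u : pred I) (o : option I) : option I :=
  if o is Some i then if u i then Some i else None else None.

Lemma weight_ge0 (V : finType) (I : eqType) (w : V -> R) (a : V -> option I) i :
  (forall x, 0 <= w x) -> 0 <= weight w a i.
Proof. by move=> w0; apply: sumr_ge0 => x _. Qed.

Lemma ccostC (V1 V2 I : finType) (w1 : V1 -> R) (a : V1 -> option I)
    (w2 : V2 -> R) (b : V2 -> option I) :
  ccost w1 a w2 b = ccost w2 b w1 a.
Proof.
rewrite /ccost addrAC; congr (_ + _ + _).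
by apply: eq_bigr => i _; rewrite distrC.
Qed.

Lemma weight_omap (V I J : finType) (w : V -> R) (a : V -> option I)
    (f : I -> J) j :
  weight w (omap f \o a) (Some j) = \sum_(i | f i == j) weight w a (Some i).
Proof.
rewrite /weight (exchange_big_dep xpredT) //= [LHS]big_mkcond /=.
apply: eq_bigr => x _; case: (a x) => [i|] /=; last by rewrite big_pred0 // => k; rewrite andbC.
rewrite (eq_bigl (fun k => (i == k) && (f i == j))); last first.
  by move=> k; rewrite andbC [Some i == _]/eq_op /=; case: (eqVneq i k) => [->|].
rewrite [Some _ == _]/eq_op /=; case: ifP => fij.
  by rewrite (big_pred1 i) // => k; rewrite andbT eq_sym.
by rewrite big_pred0 // => k; rewrite andbF.
Qed.

(** The triangle inequality, applied in each fiber of [f]. This covers the concatenation of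
    consecutive paths. *)
Lemma ccost_omap (V1 V2 I J : finType) (w1 : V1 -> R) (a : V1 -> option I)
    (w2 : V2 -> R) (b : V2 -> option I) (f : I -> J) :
  ccost w1 (omap f \o a) w2 (omap f \o b) <= ccost w1 a w2 b.
Proof.
have weight_None (V : finType) (w : V -> R) (c : V -> option I) :
    weight w (omap f \o c) None = weight w c None.
  by apply: eq_bigl => x /=; case: (c x).
rewrite /ccost !weight_None !lerD2r.
rewrite [leRHS](partition_big f xpredT) //=; apply: ler_sum => j _.
by rewrite !weight_omap -sumrB; apply: ler_norm_sum.
Qed.

(** Each vertex contributes to exactly one weight, so every change of [w] is paid for once. *)
Lemma ccost_reweight (V1 V2 I : finType) (w w1 : V1 -> R) (a : V1 -> option I)
    (w2 : V2 -> R) (b : V2 -> option I) :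
  ccost w1 a w2 b <= ccost w a w2 b + \sum_x `|w1 x - w x|.
Proof.
have wD i : weight w1 a i = weight w a i + \sum_(x | a x == i) (w1 x - w x).
  by rewrite -big_split /=; apply: eq_bigr => x _; rewrite addrC subrK.
have -> : \sum_x `|w1 x - w x| = \sum_i \sum_(x | a x == Some i) `|w1 x - w x|
                               + \sum_(x | a x == None) `|w1 x - w x|.
  rewrite (exchange_big_dep xpredT) //= addrC.
  rewrite [X in _ = X + _]big_mkcond -big_split /=; apply: eq_bigr => x _.
  case: (a x) => [i|] /=; last by rewrite big_pred0 ?addr0.
  by rewrite add0r (big_pred1 i) // => k; rewrite eq_sym.
have leN : weight w1 a None <= weight w a None + \sum_(x | a x == None) `|w1 x - w x|.
  by rewrite wD lerD2l; apply: ler_sum => x _; exact: ler_norm.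
have leS : \sum_i `|weight w1 a (Some i) - weight w2 b (Some i)| <=
    \sum_i `|weight w a (Some i) - weight w2 b (Some i)|
    + \sum_i \sum_(x | a x == Some i) `|w1 x - w x|.
  rewrite -big_split /=; apply: ler_sum => i _.
  rewrite wD addrAC; apply: le_trans (ler_normD _ _) _.
  by rewrite lerD2l; apply: ler_norm_sum.
rewrite /ccost; lra.
Qed.

(** The vertices without image under [g] join the uncolored ones; since [w1] collects the weights of
    the fibers of [g], the weights of the colors stay the same. *)
Lemma ccost_pull (V V1 V2 I : finType) (w : V -> R) (w1 : V1 -> R)
    (g : V -> option V1) (a : V1 -> option I) (w2 : V2 -> R)
    (b : V2 -> option I) :
  (forall y, w1 y = weight w g (Some y)) ->
  ccost w (obind a \o g) w2 b = ccost w1 a w2 b + weight w g None.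
Proof.
move=> w1E.
have wE i : weight w1 a i = \sum_(x | (g x != None) && (obind a (g x) == i)) w x.
  rewrite /weight (eq_bigr _ (fun y _ => w1E y)) (exchange_big_dep xpredT) //=.
  rewrite [RHS]big_mkcond; apply: eq_bigr => x _.
  case: (g x) => [y|] /=; last by rewrite big_pred0 // => y; rewrite andbC.
  case: ifP => ay.
    rewrite (big_pred1 y) // => z; rewrite andbC [Some y == _]/eq_op /= [RHS]eq_sym.
    by case: eqVneq => //= <-.
  rewrite big_pred0 // => z; rewrite andbC [Some y == _]/eq_op /=.
  by case: eqVneq => //= <-.
rewrite /ccost -[RHS]addrA (addrC _ (weight w g None)) addrA.
congr (_ + _); rewrite -addrA; congr (_ + _).
  apply: eq_bigr => i _; congr (`| _ - _|); rewrite wE.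
  by apply: eq_bigl => x /=; case: (g x).
rewrite wE /weight (bigID (fun x => g x != None)) /=; congr (_ + _).
  by apply: eq_bigl => x; rewrite andbC.
by apply: eq_bigl => x /=; case: (g x) => [y|] //=; rewrite andbC.
Qed.

(** For a color of weight zero on one side, the absolute difference of the two weights equals their
    sum, which is what erasing the color adds to the uncolored part. *)
Lemma ccost_prune (V1 V2 I : finType) (w1 : V1 -> R) (a : V1 -> option I)
    (w2 : V2 -> R) (b : V2 -> option I) (u : pred I) :
  (forall i, ~~ u i -> weight w1 a (Some i) = 0 \/ weight w2 b (Some i) = 0) ->
  (forall x, 0 <= w1 x) -> (forall x, 0 <= w2 x) ->
  ccost w1 (keep u \o a) w2 (keep u \o b) <= ccost w1 a w2 b.
Proof.
move=> ab0 w1_ge0 w2_ge0.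
have wS (V : finType) (w : V -> R) (c : V -> option I) i :
    weight w (keep u \o c) (Some i) = if u i then weight w c (Some i) else 0.
  rewrite /weight big_mkcond; case: ifP => ui.
    rewrite [RHS]big_mkcond; apply: eq_bigr => x _ /=; case: (c x) => //= j.
    have [->|ji] := eqVneq j i; first by rewrite ui.
    by case: (u j) => //; case: ifP => // ij; case/negP: ji; exact: ij.
  apply: big1 => x _ /=; case: (c x) => //= j; case uj: (u j) => //.
  by case: ifP => // ji; rewrite -(eqP (ji : j == i)) uj in ui.
have wN (V : finType) (w : V -> R) (c : V -> option I) :
    weight w (keep u \o c) None = weight w c None + \sum_(i | ~~ u i) weight w c (Some i).
  rewrite /weight (exchange_big_dep xpredT) //=.
  rewrite [X in _ = X + _]big_mkcond -big_split [LHS]big_mkcond; apply: eq_bigr => x _ /=.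
  case: (c x) => [j|] /=; last by rewrite big_pred0 ?addr0 // => j; rewrite andbC.
  rewrite add0r; case uj: (u j) => /=.
    rewrite big_pred0 // => k; rewrite [Some j == _]/eq_op /=.
    by case: (eqVneq j k) => [<-|]; rewrite ?uj ?andbF.
  rewrite (big_pred1 j) // => k /=; rewrite [RHS]eq_sym [Some j == _]/eq_op /=.
  by case: (eqVneq j k) => [<-|]; rewrite ?uj ?andbF.
rewrite /ccost !wN (bigID u) [X in _ <= X + _ + _](bigID u) /=.
rewrite [X in _ + X + _ + _]big1 => [|i /negbTE ui]; last by rewrite !wS ui subr0 normr0.
have -> : \sum_(i | u i) `|weight w1 (keep u \o a) (Some i)
      - weight w2 (keep u \o b) (Some i)| =
    \sum_(i | u i) `|weight w1 a (Some i) - weight w2 b (Some i)|.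
  by apply: eq_bigr => i ui; rewrite !wS ui.
have : \sum_(i | ~~ u i) weight w1 a (Some i)
    + \sum_(i | ~~ u i) weight w2 b (Some i) <=
    \sum_(i | ~~ u i) `|weight w1 a (Some i) - weight w2 b (Some i)|.
  rewrite -big_split /=; apply: ler_sum => i /ab0[]->; rewrite ?sub0r ?subr0 ?add0r ?addr0.
    by rewrite normrN ler_norm.
  exact: ler_norm.
lra.
Qed.

(** The extra term is twice [w1 c] if [c] was colored, for leaving one class and entering another,
    and 0 if it was not: then the uncolored weight lost pays for the change. *)
Lemma ccost_recolor (V1 V2 I : finType) (w1 : V1 -> R) (a a' : V1 -> option I)
    (w2 : V2 -> R) (b : V2 -> option I) c :
  (forall x, x != c -> a' x = a x) -> 0 <= w1 c ->
  ccost w1 a' w2 b <= ccost w1 a w2 b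
    + w1 c * ((a c != None)%:R - (a c == None)%:R) + w1 c.
Proof.
move=> aa' wc.
(* Only [c] changes class: its weight leaves the old class and enters the new one. *)
have wD i : weight w1 a' i = weight w1 a i - w1 c * (a c == i)%:R + w1 c * (a' c == i)%:R.
  have wE d : weight w1 d i = w1 c * (d c == i)%:R + \sum_(x | (x != c) && (d x == i)) w1 x.
    rewrite /weight big_mkcond (bigD1 c) //= big_mkcondr; congr (_ + _).
    by case: eqP; rewrite ?mulr1 ?mulr0.
  rewrite !wE [RHS]addrC addrAC subrr add0r; congr (_ + _).
  by apply: eq_bigl => x; case: eqVneq => //= /aa'->.
have sum1 o : \sum_i w1 c * ((o : option I) == Some i)%:R = w1 c * (o != None)%:R.
  rewrite -mulr_sumr; congr (_ * _); case: o => [i|] /=; last by rewrite big1.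
  rewrite (bigD1 i) //= eqxx big1 ?addr0 // => j ji.
  by rewrite [Some i == _]/eq_op /= eq_sym (negbTE ji).
have : \sum_i `|weight w1 a' (Some i) - weight w2 b (Some i)| <=
       \sum_i `|weight w1 a (Some i) - weight w2 b (Some i)| +
       w1 c * (a c != None)%:R + w1 c * (a' c != None)%:R.
  rewrite -!sum1 -!big_split /=; apply: ler_sum => i _; rewrite wD.
  set p := w1 c * _; set q := w1 c * _.
  have p0 : 0 <= p by rewrite mulr_ge0 // ler0n.
  have q0 : 0 <= q by rewrite mulr_ge0 // ler0n.
  set A := weight w1 a _; set B := weight w2 b _.
  rewrite (_ : A - p + q - B = A - B - p + q); last by lra.
  have := ler_normD (A - B - p) q; have := ler_normB (A - B) p.
  rewrite (ger0_norm p0) (ger0_norm q0); lra.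
rewrite /ccost wD; case: (a c) => [?|]; case: (a' c) => [?|] /=;
  rewrite ?mulr1 ?mulr0 ?subr0 ?sub0r ?mulrN1; lra.
Qed.

End Cost.

(** * Colorings *)

(* The rank only ensures that following [cpar] leads to the root; [cpar croot]
   is irrelevant. *)
Record color_tree := ColorTree {
  color :> finType;
  croot : color;
  cpar : color -> color;
  crank : color -> nat;
  crankP : forall i, i != croot -> (crank (cpar i) < crank i)%N }.

Lemma cpar_neq (J : color_tree) (i : J) : i != croot J -> cpar i != i.
Proof. by move=> /crankP ri; apply/eqP => pi; rewrite pi ltnn in ri. Qed.

(* [a x] is the color of the edge from [x] to its parent; the root, which has no
   such edge, carries the color [croot].  Each color class is a path, starting
   at the end of the path of the parent color: [col_sib] says that all other
   edges at an inner vertex of a path are uncolored, [col_top] that a path has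
   only one first edge. *)
Record coloring (R : realType) (T : merge_tree R) (J : color_tree)
    (a : T -> option J) : Prop := Coloring {
  col_root : a (troot T) = Some (croot J);
  col_rootP : forall x, a x = Some (croot J) -> x = troot T;
  col_par : forall x i, x != troot T -> a x = Some i ->
    a (par x) = Some i \/ a (par x) = Some (cpar i);
  col_sib : forall x z i, x != troot T -> z != troot T -> x != z ->
    par x = par z -> a x = Some i -> a (par x) = Some i -> a z = None;
  col_top : forall x z i, x != troot T -> z != troot T ->
    a x = Some i -> a z = Some i -> a (par x) <> Some i ->
    a (par z) <> Some i -> x = z }.

Section Coloring.
Variables (R : realType) (T : merge_tree R).

Lemma col_neq_root (J : color_tree) (a : T -> option J) x i :
  coloring a -> a x = Some i -> i != croot J -> x != troot T.
Proof.
move=> ca axi; apply: contraNneq => xr.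
by move: axi; rewrite xr (col_root ca) => -[->].
Qed.

Lemma col_neq_croot (J : color_tree) (a : T -> option J) x i :
  coloring a -> a x = Some i -> x != troot T -> i != croot J.
Proof.
by move=> ca axi; apply: contraNneq => ir; rewrite (col_rootP ca (x := x)) // axi ir.
Qed.

(** The contrapositive of the fact that unmapped edges are closed downwards; at the root it holds
    because [par] fixes the root. *)
Lemma col_par_Some (J : color_tree) (a : T -> option J) x :
  coloring a -> a x <> None -> a (par x) <> None.
Proof.
move=> ca; have [->|xr] := eqVneq x (troot T); first by rewrite par_root.
by case ax: (a x) => [i|] // _; case: (col_par ca xr ax) => ->.
Qed.

(** Climbing from any vertex of the class reaches the first edge of its path. *)
Lemma col_topP (J : color_tree) (a : T -> option J) x i :
  coloring a -> a x = Some i -> i != croot J ->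
  exists y, [/\ y != troot T, a y = Some i & a (par y) = Some (cpar i)].
Proof.
move=> ca; elim/depth_ind: x => x IHx ax ir.
have xr := col_neq_root ca ax ir.
by case: (col_par ca xr ax) => [/(IHx xr)/(_ ir)//|]; exists x.
Qed.

(** Climbing from [y] inside its class ends at a first edge, which [col_top] identifies with [x]. *)
Lemma col_depth_top (J : color_tree) (a : T -> option J) x y i :
  coloring a -> i != croot J -> a x = Some i -> a (par x) <> Some i ->
  a y = Some i -> (depth x <= depth y)%N.
Proof.
move=> ca ir ax apx; have xr := col_neq_root ca ax ir.
elim/depth_ind: y => y IHy ay; have yr := col_neq_root ca ay ir.
case: (a (par y) =P Some i) => [/(IHy yr)|apy].
  by rewrite (depth_par yr); exact: leqW.
by rewrite (col_top ca xr yr ax ay apx apy).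
Qed.

(** A color class is a chain: below its unique first edge, [col_sib] prevents branching. *)
Lemma col_depth_inj (J : color_tree) (a : T -> option J) x y i :
  coloring a -> i != croot J -> a x = Some i -> a y = Some i ->
  depth x = depth y -> x = y.
Proof.
move=> ca ir; elim/depth_ind: x y => x IHx y ax ay dxy.
have xr := col_neq_root ca ax ir; have yr := col_neq_root ca ay ir.
case: (a (par x) =P Some i) (a (par y) =P Some i) => apx [] apy.
- have /IHx : depth (par x) = depth (par y).
    by move: dxy; rewrite (depth_par xr) (depth_par yr) => -[].
  move=> /(_ xr apx apy) pxy; apply: contra_eq ay => xy.
  by rewrite (col_sib ca xr yr xy pxy ax apx).
- have := col_depth_top ca ir ay apy apx.
  by rewrite -dxy (depth_par xr) ltnn.
- have := col_depth_top ca ir ax apx apy.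
  by rewrite dxy (depth_par yr) ltnn.
- exact: (col_top ca xr yr ax ay).
Qed.

(** Found by climbing from [y] to the level just below [x], where [col_depth_inj] shows that the
    parent is [x]. *)
Lemma col_child (J : color_tree) (a : T -> option J) x y i :
  coloring a -> i != croot J -> a x = Some i -> a y = Some i ->
  (depth x < depth y)%N ->
  exists z, [/\ z != troot T, par z = x & a z = Some i].
Proof.
move=> ca ir ax; elim/depth_ind: y => y IHy ay dxy.
have yr := col_neq_root ca ay ir.
case: (a (par y) =P Some i) => apy; last first.
  by have := col_depth_top ca ir ay apy ax; rewrite leqNgt dxy.
move: dxy; rewrite (depth_par yr) ltnS leq_eqVlt => /orP[/eqP dxy|]; last exact: IHy.
by exists y; split=> //; apply: col_depth_inj ca ir apy ax _.
Qed.

(** The vertices of a tree serve as colors. Colorings by the vertices of another tree then act as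
    maps between trees, which can be composed with colorings. *)
Definition vertex_colors : color_tree :=
  @ColorTree (vertex T) (troot T) (@par R T) (@depth R T)
    (fun x xr => eq_leq (esym (depth_par xr))).

Lemma coloring_id : @coloring R T vertex_colors Some.
Proof.
split => //=.
- by move=> x [].
- by move=> x i _ [<-]; right.
- by move=> x z i xr _ _ _ [<-] [/eqP]; rewrite (negbTE (par_neq xr)).
- by move=> x z i _ _ [->] [->].
Qed.

(** A path can be kept only along with all paths above it, hence the closure of [u] under [cpar]. *)
Lemma coloring_keep (J : color_tree) (a : T -> option J) (u : pred J) :
  coloring a -> u (croot J) ->
  (forall i, i != croot J -> u i -> u (cpar i)) -> coloring (keep u \o a).
Proof.
move=> ca ur up.
have keepP x i : (keep u \o a) x = Some i <-> a x = Some i /\ u i.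
  rewrite /=; case: (a x) => [j|] /=; last by split=> [|[]].
  case: ifPn => uj; first by split=> [[<-]|[]].
  by split=> [//|[[ji]]]; rewrite -ji (negbTE uj).
split.
- exact/keepP/(conj (col_root ca) ur).
- by move=> x /keepP[/(col_rootP ca)].
- move=> x i xr /keepP[axi ui]; have ir := col_neq_croot ca axi xr.
  by case: (col_par ca xr axi) => api; [left|right]; apply/keepP; rewrite ?up.
- by move=> x z i xr zr xz pxz /keepP[ax _] /keepP[px _] /=; rewrite (col_sib ca xr zr xz pxz ax px).
- move=> x z i xr zr /keepP[ax ui] /keepP[az _] px pz.
  by apply: (col_top ca xr zr ax az) => api; [apply: px|apply: pz]; apply/keepP.
Qed.

End Coloring.

(** The edges of [T'] used by [g] stand for paths in [T]; composing concatenates these along the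
    paths that [a] describes in [T']. *)
Lemma coloring_comp (R : realType) (T T' : merge_tree R) (J : color_tree)
    (g : T -> option (vertex_colors T')) (a : T' -> option J) :
  coloring g -> coloring a -> coloring (obind a \o g).
Proof.
move=> cg ca.
have compP x i : (obind a \o g) x = Some i -> exists2 y, g x = Some y & a y = Some i.
  by rewrite /=; case: (g x) => //= y; exists y.
have topP x y i : x != troot T -> g x = Some y -> a y = Some i ->
    (obind a \o g) (par x) <> Some i ->
    [/\ y != troot T', g (par x) = Some (par y) & a (par y) <> Some i].
  move=> xr gx ay /=; have yr := col_neq_croot cg gx xr.
  by case: (col_par cg xr gx) => -> /=.
split.
- by rewrite /= (col_root cg) /= (col_root ca).
- by move=> x /compP[y gx /(col_rootP ca) yr]; apply: (col_rootP cg); rewrite gx yr.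
- move=> x i xr /compP[y gx ay] /=; have yr := col_neq_croot cg gx xr.
  case: (col_par cg xr gx) => -> /=; first by left.
  exact: col_par.
- move=> x z i xr zr xz pxz /compP[y gx ay] /compP[y' gpx ay'] /=.
  have yr := col_neq_croot cg gx xr.
  case gz: (g z) => [z'|] //=; have z'r := col_neq_croot cg gz zr.
  (* If [x] and its parent lie on the same edge of [T'], then [z] is left uncolored by [g]
     already. *)
  have [y'E|y'E] : y' = y \/ y' = par y.
    by case: (col_par cg xr gx); rewrite gpx => -[->]; [left|right].
    by rewrite (col_sib cg xr zr xz pxz gx) ?gpx ?y'E in gz.
  (* Otherwise the path of [a] passes from [y'] to its child [y] in [T'], and the edge [z']
     containing [z] turns out to be a sibling of [y], so [col_sib] for [a] applies. *)
  have y'y : y' != y by rewrite y'E par_neq.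
  have y'z' : y' != z'.
    apply/eqP => y'z'; rewrite (col_sib cg zr xr _ (esym pxz) gz) // in gx.
      by rewrite eq_sym.
    by rewrite -pxz gpx y'z'.
  have pz' : par z' = y'.
    case: (col_par cg zr gz); rewrite -pxz gpx => -[] // /eqP.
    by rewrite (negbTE y'z').
  rewrite y'E in pz' ay'.
  apply: (col_sib ca yr z'r _ (esym pz') ay ay'); apply/eqP => yz'.
  case/eqP: xz; apply: (col_top cg xr zr gx); rewrite ?gz ?yz' //.
    by rewrite gpx => -[/eqP]; rewrite -yz' (negbTE y'y).
  by rewrite -pxz gpx => -[/eqP]; rewrite (negbTE y'z').
- move=> x z i xr zr /compP[y gx ay] /compP[z' gz az'] nx nz.
  have [yr gpx npy] := topP _ _ _ xr gx ay nx.
  have [z'r gpz npz'] := topP _ _ _ zr gz az' nz.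
  have yz' := col_top ca yr z'r ay az' npy npz'; rewrite -yz' in gz gpz.
  apply: (col_top cg xr zr gx gz); rewrite ?gpx ?gpz => -[/eqP]; exact/negP/par_neq.
Qed.

(* Concatenation of the path of color [j] to the path of its parent color. *)
Section Collapse.
Variables (J : color_tree) (j : J).
Hypothesis jr : j != croot J.

Definition collapse (k : J) : J := if k == j then cpar j else k.

Lemma collapse_rankP i :
  i != croot J -> (crank (collapse (cpar i)) < crank i)%N.
Proof.
move=> ir; rewrite /collapse; case: eqP => [pi|_]; last exact: crankP.
by apply: ltn_trans (crankP jr) _; rewrite -pi crankP.
Qed.

Definition collapse_tree : color_tree := ColorTree collapse_rankP.

(** If another used color had the parent [cpar j], its path would start at an inner vertex of the
    concatenated path; the last hypothesis excludes this. *)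
Lemma coloring_collapse (R : realType) (T : merge_tree R) (a : T -> option J) :
  coloring a -> cpar j != croot J ->
  (forall x k, a x = Some k -> k != croot J -> cpar k = cpar j -> k = j) ->
  @coloring R T collapse_tree (omap collapse \o a).
Proof.
move=> ca pjr uj; set i := cpar j.
have ij : i != j := cpar_neq jr.
have ji_par x : x != troot T -> a x = Some i -> a (par x) <> Some j.
  move=> xr ax apx; case: (col_par ca xr ax); rewrite apx => -[] jE.
    by rewrite jE eqxx in ij.
  by have := ltn_trans (crankP pjr) (crankP jr); rewrite -/i -jE ltnn.
have colP x k : (omap collapse \o a) x = Some k ->
    exists2 l, a x = Some l & collapse l = k.
  by rewrite /=; case: (a x) => //= l [<-]; exists l.
have colI x : a x = Some i \/ a x = Some j -> (omap collapse \o a) x = Some i.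
  by rewrite /= /collapse => -[]-> /=; rewrite ?eqxx ?(negbTE ij).
have colK x k : a x = Some k -> k != j -> (omap collapse \o a) x = Some k.
  by rewrite /= /collapse => -> kj /=; rewrite (negbTE kj).
have lE l k : collapse l = k -> (l = k /\ k != j) \/ (l = j /\ k = i).
  by rewrite /collapse; case: eqVneq => [->|lj] <-; [right|left].
split.
- by apply: colK (col_root ca) _; rewrite eq_sym.
- move=> x /colP[l ax /lE[[lr _]|[_ /eqP]]].
    by apply: (col_rootP ca); rewrite ax lr.
  by rewrite eq_sym (negbTE pjr).
- move=> x k xr /colP[l ax /lE[[lk kj]|[lj ->]]].
    rewrite lk in ax; case: (col_par ca xr ax) => apx.
      by left; apply: colK.
    by right; rewrite /= apx.
  rewrite lj in ax; left; apply: colI.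
  by case: (col_par ca xr ax) => ->; [right|left].
- move=> x z k xr zr xz pxz /colP[l ax lk] /colP[m apx mk] /=.
  suff -> : a z = None by [].
  have [ml|ml] := eqVneq m l; first by apply: (col_sib ca xr zr xz pxz ax); rewrite -ml.
  case: (lE _ _ lk) (lE _ _ mk) => [[lkE kj]|[lkE kE]] [[mkE _]|[mkE kE']].
  + by rewrite lkE mkE eqxx in ml.
  + by rewrite lkE kE' in ax; rewrite mkE in apx; case: (ji_par x xr ax).
  (* At the junction, [x] starts path [j] and its parent ends path [i]. A colored sibling would
     either continue path [i], against [col_sib], or start a path following it, hence [j] itself,
     against [col_top]. *)
  + case az: (a z) => [n|] //; have nr := col_neq_croot ca az zr.
    case: (col_par ca zr az); rewrite -pxz apx mkE kE => -[] nE.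
      have := col_sib ca zr xr _ (esym pxz) az; rewrite -pxz apx ax mkE kE nE.
      by rewrite eq_sym => /(_ xz erefl).
    have nj := uj _ _ az nr (esym nE).
    case/eqP: xz; apply: (col_top ca xr zr ax); rewrite ?az ?nj ?lkE -?pxz ?apx //;
    by rewrite mkE kE => -[/eqP]; rewrite (negbTE ij).
  + by rewrite lkE mkE eqxx in ml.
- move=> x z k xr zr /colP[l ax lk] /colP[m az mk] npx npz.
  have top y n : y != troot T -> a y = Some n -> collapse n = k ->
      (omap collapse \o a) (par y) <> Some k -> n = k /\ a (par y) <> Some k.
    move=> yr ay /lE[[-> kj]|[nj kE]] npy; first by split=> // /colK/(_ kj).
    rewrite nj in ay; case: npy; rewrite kE; apply: colI.
    by case: (col_par ca yr ay) => ->; [right|left].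
  have [lE' px] := top _ _ xr ax lk npx; have [mE pz] := top _ _ zr az mk npz.
  by rewrite lE' in ax; rewrite mE in az; apply: (col_top ca xr zr ax az).
Qed.

End Collapse.

(** * Recoloring a single vertex *)

Section Recolor.
Variables (R : realType) (T : merge_tree R) (J : color_tree) (a : T -> option J).
Hypothesis ca : coloring a.

Definition recolor (c : T) (o : option J) (x : T) := if x == c then o else a x.

(** The uncolored vertices have to stay closed downwards, hence the condition on the children. *)
Lemma coloring_erase c : c != troot T ->
  (forall x, x != troot T -> par x = c -> a x = None) ->
  coloring (recolor c None).
Proof.
move=> cr child.
have recP x i : recolor c None x = Some i <-> a x = Some i /\ x <> c.
  by rewrite /recolor; case: eqP => xc; split => // -[].
have parP x i : x != troot T -> a x = Some i -> par x <> c.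
  by move=> xr ax /(child _ xr); rewrite ax.
split.
- by apply/recP; split; [exact: col_root|apply/eqP; rewrite eq_sym].
- by move=> x /recP[/(col_rootP ca)].
- move=> x i xr /recP[ax xc].
  by case: (col_par ca xr ax) => apx; [left|right]; apply/recP; split=> //; exact: parP ax.
- move=> x z i xr zr xz pxz /recP[ax _] /recP[apx _].
  by rewrite /recolor; case: eqP => // _; exact: col_sib pxz ax apx.
- move=> x z i xr zr /recP[ax _] /recP[az _] npx npz.
  by apply: (col_top ca xr zr ax az) => ap; [apply: npx|apply: npz];
    apply/recP; split=> //; apply: parP; eassumption.
Qed.

(** Since no edge below [par c] is colored, path [i] ends there and can be extended by the edge
    above [c]. *)
Lemma coloring_extend c i : c != troot T -> par c != troot T ->
  a (par c) = Some i ->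
  (forall x, x != troot T -> par x = par c -> a x = None) ->
  coloring (recolor c (Some i)).
Proof.
move=> cr pr apc child.
have ac : a c = None by exact: child.
have ir : i != croot J := col_neq_croot ca apc pr.
have recN x : x != c -> recolor c (Some i) x = a x.
  by rewrite /recolor => /negbTE->.
have parP x k : x != troot T -> a x = Some k -> par x != c.
  move=> xr ax; apply/eqP => pxc.
  by have := @col_par_Some _ _ _ _ x ca; rewrite ax pxc ac; apply.
have pcc : par c != c by apply: par_neq.
split.
- by rewrite recN ?(col_root ca) // eq_sym.
- move=> x; rewrite /recolor; case: eqP => [_ [iE]|_]; last exact: col_rootP.
  by rewrite iE eqxx in ir.
- move=> x k xr; rewrite {1}/recolor; case: eqVneq => [-> [<-]|xc ax].
    by left; rewrite recN.
  by rewrite recN; [exact: col_par|exact: parP ax].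
- move=> x z k xr zr xz pxz; have [xc|xc] := eqVneq x c.
    by move=> _ _; rewrite xc in xz pxz; rewrite recN 1?eq_sym // child.
  rewrite recN // => ax; rewrite recN ?(parP _ _ xr ax) // => apx.
  have [zc|zc] := eqVneq z c; last by rewrite recN // (col_sib ca xr zr xz pxz ax apx).
  by rewrite zc in pxz; rewrite child in ax.
- have ctop x k : x != troot T -> recolor c (Some i) x = Some k ->
      recolor c (Some i) (par x) <> Some k -> [/\ x != c, a x = Some k & a (par x) <> Some k].
    move=> xr; have [->|xc] := eqVneq x c; first by rewrite {1}/recolor eqxx recN // => -[<-].
    by rewrite recN // => ax; rewrite recN ?(parP _ _ xr ax).
  move=> x z k xr zr rx rz npx npz.
  have [_ ax px] := ctop _ _ xr rx npx; have [_ az pz] := ctop _ _ zr rz npz.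
  exact: (col_top ca xr zr ax az).
Qed.

End Recolor.

(** * Deletions as colorings *)

(* [f y] is the last vertex of the path of [T] that is contracted to the edge
   above [y]. *)
Record contraction (R : realType) (T T' : merge_tree R) (f : T' -> T)
    (g : T -> option (vertex_colors T')) : Prop := Contraction {
  ctr_col : coloring g;
  ctr_fK : forall y, g (f y) = Some y;
  ctr_top : forall y, y != troot T' ->
    exists x, [/\ x != troot T, g x = Some y & par x = f (par y)] }.

Section Contraction.
Variables (R : realType) (T T' : merge_tree R).
Variables (f : T' -> T) (g : T -> option (vertex_colors T')).

(** The equation says that [a] is constant on the fibers of [g] and colors nothing outside the
    domain of [g], so that it descends to [T']. *)
Lemma coloring_factor (J : color_tree) (a : T -> option J) :
  contraction f g -> coloring a -> obind (a \o f) \o g =1 a ->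
  coloring (a \o f).
Proof.
move=> [cg fK top] ca aE.
have fr : f (troot T') = troot T by apply: (col_rootP cg); rewrite fK.
have topP y i : y != troot T' -> a (f y) = Some i ->
    exists x, [/\ x != troot T, g x = Some y, par x = f (par y) & a x = Some i].
  by move=> /top[x [xr gx px]] ay; exists x; split; rewrite // -aE /= gx.
split.
- by rewrite /= fr (col_root ca).
- by move=> y /= /(col_rootP ca) fy; have := fK y; rewrite fy (col_root cg) => -[].
- by move=> y i yr /(topP _ _ yr)[x [xr _ px /(col_par ca xr)]]; rewrite px.
- move=> y z i yr zr yz pyz /(topP _ _ yr)[x [xr gx px ax]] /= apy.
  have [w [wr gw pw]] := top z zr.
  have <- : a w = a (f z) by rewrite -[LHS]aE /= gw.
  apply: (col_sib ca xr wr _ _ ax); rewrite ?px ?pw ?pyz //; last by rewrite -pyz.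
  by apply: contraNneq yz => xw; move: gw; rewrite -xw gx => -[->].
- move=> y z i yr zr /(topP _ _ yr)[x [xr gx px ax]] /(topP _ _ zr)[w [wr gw pw aw]].
  rewrite /= -px -pw => nx nw; have xw := col_top ca xr wr ax aw nx nw.
  by move: gw; rewrite -xw gx => -[].
Qed.

Hypotheses (f_inj : injective f) (fr : f (troot T') = troot T).

Definition finv_opt (x : T) : option (vertex_colors T') := [pick y | f y == x].

Lemma finv_optP x y : finv_opt x = Some y <-> x = f y.
Proof.
rewrite /finv_opt; case: pickP => [z /eqP<-|/(_ y) fy].
  by split=> [[->]//|/f_inj ->].
by split=> // xf; rewrite xf eqxx in fy.
Qed.

Lemma finv_opt_None (A : {set T}) x :
  [set f y | y : T']%SET = A -> finv_opt x = None <-> x \notin A.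
Proof.
move=> <-; split=> [fx|]; first by apply/imsetP => -[y _ /finv_optP]; rewrite fx.
move=> xf; rewrite /finv_opt; case: pickP => // y /eqP fy.
by case/negP: xf; rewrite -fy imset_f.
Qed.

(** For isomorphisms, and for deletions that remove only one vertex. *)
Lemma embedding_contraction :
  (forall y, y != troot T' -> f (par y) = par (f y)) -> contraction f finv_opt.
Proof.
move=> fpar.
have nr y : y != troot T' -> f y != troot T.
  by apply: contra_neq => fy; apply: f_inj; rewrite fr.
have nr' y : f y != troot T -> y != troot T'.
  by apply: contra_neq => ->.
split.
- split.
  + by apply/finv_optP; rewrite fr.
  + by move=> x /finv_optP ->.
  + move=> x y xr /finv_optP xf; right; apply/finv_optP.
    by rewrite xf -fpar // nr' // -xf.
  + move=> x z y xr _ _ _ /finv_optP xy /finv_optP/eqP.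
    by rewrite -xy (negbTE (par_neq xr)).
  + by move=> x z y _ _ /finv_optP-> /finv_optP->.
- by move=> y; apply/finv_optP.
- by move=> y yr; exists (f y); split; [exact: nr|exact/finv_optP|rewrite fpar].
Qed.

End Contraction.

Section Deletion.
Variables (R : realType) (T T' : merge_tree R).

Lemma par_edge (x y : T) : edge x y -> par x = y.
Proof. by rewrite edgeE => /andP[_ /eqP]. Qed.

Lemma root_edge (x y : T) : edge x y -> x != troot T.
Proof. by rewrite edgeE => /andP[]. Qed.

Lemma leafP (c : T) : leaf c <-> (forall x, x != troot T -> par x <> c).
Proof.
rewrite /leaf /deg; split=> [/cards0_eq c0 x xr pc|nc].
  have : x \in children (@edge _ T) c by rewrite inE -pc edge_par.
  by rewrite c0 inE.
apply/eqP; rewrite cards_eq0; apply/eqP/finset.setP => x; rewrite !inE.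
by apply/negP => xc; apply: (nc x); [exact: root_edge xc|exact: par_edge].
Qed.

(** Both kinds of deletion in one form. The final alternative tells whether the fibers of [g] are
    singletons or the edges above [c'] and [p] are merged into one, which [f] sends to its lower end
    [c']. *)
Lemma deletion_contraction (c p : T) :
  deletion c p T' ->
  exists (f : T' -> T) (g : T -> option (vertex_colors T')),
    [/\ contraction f g, forall y, wt y = weight (@wt R T) g (Some y),
        forall x, g x = None <-> x = c &
        (forall x y, g x = Some y -> x = f y) \/
        exists c', [/\ c' != troot T, par c' = p, c' != c,
          forall x, x != troot T -> par x = p -> x = c \/ x = c' &
          forall x y, g x = Some y -> x = f y \/ x = p /\ f y = c']].
Proof.
move=> [cp cl pr [[_ [f [f_inj fA fr fe fl]]]|[c' [p' [ch pp' [f [f_inj fA fr fe fl]]]]]]].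
  have fpar y : y != troot T' -> f (par y) = par (f y).
    by move=> /edge_par; rewrite fe => /par_edge.
  exists f, (finv_opt f); have ctr := embedding_contraction f_inj fr fpar.
  split=> //; last by left=> x y /(finv_optP f_inj).
  - move=> y; rewrite /weight (big_pred1 (f y)); last first.
      by move=> x /=; apply/eqP/eqP => /(finv_optP f_inj).
    have [->|yr] := eqVneq y (troot T'); first by rewrite fr !wt_root.
    have yp := edge_par yr; rewrite -(label_wt yp) fl // label_wt -?fe //.
  - by move=> x; rewrite (finv_opt_None f_inj _ fA) !inE negbK; split=> /eqP.
have /finset.setP chP := ch.
have c'P x : edge x p = (x == c) || (x == c').
  have := chP x; rewrite !inE; case: eqVneq => [->|_] /=; rewrite ?cp //.
have c'p : edge c' p by rewrite c'P eqxx orbT.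
have [c'r pc'] := (root_edge c'p, par_edge c'p).
have c'c : c' != c by have := chP c'; rewrite !inE eqxx => /andP[].
have c'np : c' != p by rewrite -pc' eq_sym par_neq.
have ppar := par_edge pp'.
have imf x : (exists y, x = f y) <-> x <> c /\ x <> p.
  have /finset.setP/(_ x) := fA; rewrite !inE negb_or => fx.
  split=> [[y xy]|[/eqP xc /eqP xp]].
    by move: fx; rewrite {1}xy imset_f // => /esym/andP[/eqP ? /eqP].
  by move: fx; rewrite xc xp => /imsetP[y _ ->]; exists y.
(* [y0] carries the edge of [T'] that replaces those above [c'] and [p]. *)
have [y0 fy0] : exists y, c' = f y by apply/imf; split; exact/eqP.
have fnp y : f y <> p by have [] := (imf (f y)).1 (ex_intro _ y erefl).
have fnc y : f y <> c by have [] := (imf (f y)).1 (ex_intro _ y erefl).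
have y0r : y0 != troot T' by apply: contraNneq c'r => y0r; rewrite fy0 y0r fr.
have nr y : y != troot T' -> f y != troot T.
  by apply: contra_neq => fy; apply: f_inj; rewrite fr.
have nr' y : f y != troot T -> y != troot T' by apply: contra_neq => ->.
have fpar0 : f (par y0) = p'.
  have := edge_par y0r; rewrite fe -fy0 xpair_eqE eqxx => /orP[/par_edge|/eqP//].
  by rewrite pc' => /esym/fnp.
have fpar y : y != troot T' -> y != y0 -> f (par y) = par (f y).
  move=> yr yy0; have := edge_par yr; rewrite fe xpair_eqE => /orP[/par_edge//|].
  by rewrite fy0 (inj_eq f_inj) (negbTE yy0).
(* Giving [p] the color [y0] as well turns the two merged edges into one path. *)
pose g x := if x == p then Some y0 else finv_opt f x.
have gP x y : g x = Some y <-> x = f y \/ x = p /\ y = y0.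
  rewrite /g; case: eqP => [->|xp].
    by split=> [[->]|[/esym/fnp//|[_ ->//]]]; right.
  by rewrite (finv_optP f_inj); split=> [|[|[]]] //; left.
have gNone x : g x = None <-> x = c.
  rewrite /g; case: eqP => [->|/eqP xp].
    by split=> // pc; have := par_neq (root_edge cp); rewrite (par_edge cp) pc eqxx.
  by rewrite (finv_opt_None f_inj _ fA) !inE (negbTE xp) orbF negbK; split=> /eqP.
have gf y : g (f y) = Some y by apply/gP; left.
have gp : g p = Some y0 by apply/gP; right.
exists f, g; split=> //.
- split=> //.
  + split=> /=.
    * by rewrite -fr gf.
    * by move=> x /gP[->//|[_ yr]]; rewrite yr eqxx in y0r.
    * move=> x y xr /gP[xy|[-> ->]]; last by right; rewrite ppar -fpar0 gf.
      have [yy0|yy0] := eqVneq y y0; first by left; rewrite xy yy0 -fy0 pc' gp.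
      by right; rewrite xy -fpar ?gf // nr' -?xy.
    * move=> x z y xr zr xz pxz /gP[xy|[xp yy0]] /gP[pxy|[pxp yy0']].
      - by have := par_neq xr; rewrite pxy xy eqxx.
      - have xc' : x = c' by rewrite xy yy0' fy0.
        have := edge_par zr; rewrite -pxz pxp c'P -xc' (eq_sym z x) (negbTE xz) orbF.
        by move=> /eqP/gNone.
      - move: pxy; rewrite xp yy0 -fy0 => pc.
        have := depth_par pr; rewrite pc (depth_par c'r) pc' => /eqP.
        by rewrite ltn_eqF // ltnS leqnSn.
      - by have := par_neq xr; rewrite pxp xp eqxx.
    * move=> x z y xr zr /gP[xy|[xp yy0]] /gP[zy|[zp yy0']].
      - by rewrite xy zy.
      - by rewrite xy yy0' -fy0 pc' gp.
      - by rewrite zy yy0 -fy0 pc' gp.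
      - by rewrite xp zp.
  + move=> y yr; have [->|yy0] := eqVneq y y0.
      by exists p; rewrite gp fpar0 ppar; split.
    by exists (f y); rewrite gf fpar //; split=> //; exact: nr.
- move=> y; have [->|yy0] := eqVneq y y0.
    rewrite /weight (bigD1 p) ?gp //= (big_pred1 c'); last first.
      move=> x /=; apply/andP/eqP => [[/eqP/gP[->//|[->]]]|->]; first by rewrite eqxx.
      by rewrite fy0 gf eqxx -fy0.
    have yp := edge_par y0r; rewrite -(label_wt yp) fl // fpar0 -fy0 eqxx addrC.
    by rewrite !label_wt.
  rewrite /weight (big_pred1 (f y)); last first.
    by move=> x /=; apply/eqP/eqP => [/gP[|[_ /eqP]]|->] //; rewrite (negbTE yy0).
  have [->|yr] := eqVneq y (troot T'); first by rewrite fr !wt_root.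
  have yp := edge_par yr; rewrite -(label_wt yp) fl // fpar // xpair_eqE.
  by rewrite [in X in X && _]fy0 (inj_eq f_inj) (negbTE yy0) /= label_wt // edge_par // nr.
- right; exists c'; split=> //.
    by move=> x xr px; have := edge_par xr; rewrite px c'P => /orP[]/eqP; [left|right].
  by move=> x y /gP[->|[-> ->]]; [left|right; rewrite -fy0].
Qed.

End Deletion.

(** * From edit sequences to matchings *)

(** Paths of the two trees are paired by having the same color. The common color tree makes the
    predecessors of paired paths paired as well, which is the third condition on path mappings. *)
Record matching (R : realType) (T1 T2 : merge_tree R) (J : color_tree)
    (a : T1 -> option J) (b : T2 -> option J) : Prop := Matching {
  mat_col1 : coloring a;
  mat_col2 : coloring b;
  mat_used : forall i, (exists x, a x = Some i) <-> (exists y, b y = Some i) }.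

(** Some edge is mapped. The root edge is then mapped too, which matters because it can never be
    deleted. *)
Definition colored (R : realType) (T : merge_tree R) (J : color_tree)
    (a : T -> option J) : Prop := exists2 x, x != troot T & a x <> None.

Notation mcost a b := (ccost (@wt _ _) a (@wt _ _) b).

Section Matching.
Variable R : realType.
Implicit Types (T : merge_tree R) (J : color_tree).

Lemma matchingC T1 T2 J (a : T1 -> option J) (b : T2 -> option J) :
  matching a b -> matching b a.
Proof. by case=> ca cb ab; split=> // i; split=> /ab. Qed.

Lemma matching_colored T1 T2 J (a : T1 -> option J) (b : T2 -> option J) :
  matching a b -> colored a -> colored b.
Proof.
move=> [ca cb ab] [x xr]; case ax: (a x) => [i|] // _.
have [y bY] := (ab i).1 (ex_intro _ x ax); exists y; last by rewrite bY.
exact: col_neq_root cb bY (col_neq_croot ca ax xr).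
Qed.

(** Colors used in one tree only are dropped. The remaining ones are closed under [cpar], because in
    both trees a path starts below an edge of the parent color. *)
Lemma matching_keep T1 T2 J (a : T1 -> option J) (b : T2 -> option J) :
  coloring a -> coloring b ->
  exists u : pred J, matching (keep u \o a) (keep u \o b) /\
    mcost (keep u \o a) (keep u \o b) <= mcost a b.
Proof.
move=> ca cb; pose u i := [exists x, a x == Some i] && [exists y, b y == Some i].
have uP i : u i -> (exists x, a x = Some i) /\ (exists y, b y = Some i).
  by case/andP => /existsP[x /eqP ax] /existsP[y /eqP bY]; split; [exists x|exists y].
have uI x y i : a x = Some i -> b y = Some i -> u i.
  by move=> ax bY; apply/andP; split; apply/existsP; [exists x|exists y]; apply/eqP.
have ur : u (croot J) := uI _ _ _ (col_root ca) (col_root cb).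
have up i : i != croot J -> u i -> u (cpar i).
  move=> ir /uP[[x ax] [y bY]].
  have [x' [_ _ apx]] := col_topP ca ax ir; have [y' [_ _ bpy]] := col_topP cb bY ir.
  exact: uI apx bpy.
exists u; split; last first.
  apply: ccost_prune; try exact: wt_ge0.
  move=> i; rewrite negb_and => /orP[]/existsPn ni; [left|right];
  by rewrite /weight big_pred0 // => x; apply/negbTE.
split; try exact: coloring_keep.
move=> i; split=> -[x] /=.
  case ax: (a x) => [k|] //=; case: ifP => // /uP[_ [y bY]] [ki].
  by exists y; rewrite bY /= -ki; case: ifPn => // /negP[]; apply: uI ax bY.
case bx: (b x) => [k|] //=; case: ifP => // /uP[[y ay] _] [ki].
by exists y; rewrite ay /= -ki; case: ifPn => // /negP[]; apply: uI ay bx.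
Qed.

Lemma matching_pull T T' T2 J (f : T' -> T) (g : T -> option (vertex_colors T'))
    (a : T' -> option J) (b : T2 -> option J) :
  contraction f g -> matching a b -> matching (obind a \o g) b.
Proof.
move=> [cg fK _] [ca cb ab]; split=> //; first exact: coloring_comp.
move=> i; rewrite -ab; split=> -[x].
  by rewrite /=; case: (g x) => //= y; exists y.
by move=> ax; exists (f x); rewrite /= fK.
Qed.

Lemma matching_factor T T' T2 J (f : T' -> T) (g : T -> option (vertex_colors T'))
    (a : T -> option J) (b : T2 -> option J) :
  contraction f g -> matching a b -> obind (a \o f) \o g =1 a ->
  matching (a \o f) b.
Proof.
move=> ctr [ca cb ab] aE; split=> //; first exact: coloring_factor ctr _ _.
move=> i; rewrite -ab; split=> -[x]; first by exists (f x).
by rewrite -[a x]aE /=; case: (g x) => //= y; exists y.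
Qed.

Lemma weight_None1 T T' (g : T -> option (vertex_colors T')) c :
  (forall x, g x = None <-> x = c) -> weight (@wt R T) g None = wt c.
Proof.
by move=> gN; rewrite /weight (big_pred1 c) // => x; apply/eqP/eqP => /gN.
Qed.

(** The deleted edge is left unmapped in the larger tree; every other edge takes the color of the
    edge of [T'] containing it. *)
Lemma deletion_matching_pull T T' T2 c p J (a : T' -> option J)
    (b : T2 -> option J) :
  deletion (T := T) c p T' -> matching a b ->
  exists a' : T -> option J, matching a' b /\ mcost a' b = mcost a b + wt c.
Proof.
move=> /deletion_contraction[f [g [ctr wE gN _]]] mab.
exists (obind a \o g); split; first exact: matching_pull ctr mab.
by rewrite (ccost_pull _ _ _ wE) (weight_None1 gN).
Qed.

(** No child of [x] has its color, so [x] ends its path, and path [k] starts there: a start further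
    up would contradict [col_sib], one further down would give [x] a child of its own color. *)
Lemma col_end_child T J (a : T -> option J) x k :
  coloring a -> a x <> None -> x != troot T ->
  (forall z, z != troot T -> par z = x -> a z <> a x) ->
  (exists y, a y = Some k) -> k != croot J -> a x = Some (cpar k) ->
  exists y, [/\ y != troot T, par y = x & a y = Some k].
Proof.
move=> ca _ xr nch [y ay] kr ax; have ir := col_neq_croot ca ax xr.
have [z [zr az apz]] := col_topP ca ay kr.
exists z; split=> //; case: (ltngtP (depth (par z)) (depth x)) => [dz|dz|].
- have [w [wr pw aw]] := col_child ca ir apz ax dz.
  have wz : w != z.
    apply/eqP => wz; move: aw; rewrite wz az => -[kE].
    by have := cpar_neq kr; rewrite -kE eqxx.
  by rewrite (col_sib ca wr zr wz pw aw) // pw in az.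
- have [w [wr pw aw]] := col_child ca ir ax apz dz.
  by case: (nch w wr pw); rewrite aw ax.
- exact: col_depth_inj ca ir apz ax.
Qed.

(** The main reduction, used for insertions in the lower bound and for unmapped edges in the upper
    bound. Once merged edges have equal color, the coloring factors through [T'], and the unmapped
    [c] accounts for [wt c]. *)
Lemma deletion_matching T T' T2 c p J (a : T -> option J) (b : T2 -> option J) :
  deletion (T := T) c p T' -> matching a b -> a c = None ->
  exists (J' : color_tree) (a' : T' -> option J') (b' : T2 -> option J'),
    [/\ matching a' b', mcost a' b' + wt c <= mcost a b & colored a -> colored a'].
Proof.
move=> dcp; have [cp _ pr _] := dcp.
have [f [g [ctr wE gN fgE]]] := deletion_contraction dcp.
have factor J0 (a0 : T -> option J0) (b0 : T2 -> option J0) :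
    matching a0 b0 -> obind (a0 \o f) \o g =1 a0 ->
    [/\ matching (a0 \o f) b0, mcost (a0 \o f) b0 + wt c = mcost a0 b0 &
        colored a0 -> colored (a0 \o f)].
  move=> mab aE; split; first exact: matching_factor ctr mab aE.
    rewrite -(weight_None1 gN) -(ccost_pull _ _ _ wE).
    by congr (ccost _ _ _ _); apply/funext.
  move=> [x xr]; rewrite -[a0 x]aE /=; case gx: (g x) => [y|] //= ay.
  by exists y => //; exact: col_neq_croot (ctr_col ctr) gx xr.
case: fgE => [gf|[c' [c'r pc' c'c ch gf]]] mab ac.
  exists J, (a \o f), b; case: (factor _ _ _ mab) => [x /=|m <- col]; last by split.
  by case gx: (g x) => [y|] /=; [rewrite -(gf _ _ gx)|move/gN: gx => ->].
(* It remains to give the edges above [p] and its remaining child [c'] the same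
   color. *)
have reduce J0 (a0 : T -> option J0) (b0 : T2 -> option J0) : matching a0 b0 ->
    a0 c = None -> a0 p = a0 c' -> obind (a0 \o f) \o g =1 a0.
  move=> m0 a0c a0p x /=; case gx: (g x) => [y|] /=; last by move/gN: gx => ->.
  by case: (gf _ _ gx) => [->//|[-> ->]].
have [ca cb ab] := mab.
(* With [p] uncolored, so is [c'] below it. *)
case apE: (a p) => [i|]; last first.
  have ac' : a c' = None.
    by case ac': (a c') => //; case: (@col_par_Some _ _ _ _ c' ca); rewrite ?ac' ?pc'.
  exists J, (a \o f), b; case: (factor _ _ _ mab) => [|m <- col]; last by split.
  by apply: (reduce _ _ _ mab); rewrite ?apE.
have ir := col_neq_croot ca apE pr.
have c'p : c' != p by rewrite -pc' eq_sym par_neq.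
have pc : p != c by rewrite -(par_edge cp) par_neq // (root_edge cp).
(* If [c'] is unmapped like [c], the path through [p] ends there and is extended by the edge above
   [c'] at no additional cost. *)
case ac': (a c') => [j|]; last first.
  have m0 : matching (recolor a c' (Some i)) b.
    split=> //.
      apply: coloring_extend; rewrite ?pc' // => x xr px.
      by case: (ch _ xr px) => ->.
    move=> k; rewrite -ab; split=> -[x]; rewrite /recolor.
      by case: eqP => [_ <-|_ <-]; [exists p|exists x].
    by move=> ax; exists x; case: eqP => // xc'; rewrite xc' ac' in ax.
  exists J, (recolor a c' (Some i) \o f), b; case: (factor _ _ _ m0) => [|m -> col].
    apply: (reduce _ _ _ m0); rewrite /recolor.
      by rewrite eq_sym (negbTE c'c).
    by rewrite eqxx eq_sym (negbTE c'p).
  split=> //.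
    apply: le_trans (ccost_recolor (a := a) (c := c') _ _ _ _) _.
    - by move=> x xc'; rewrite /recolor (negbTE xc').
    - exact: wt_ge0.
    - by rewrite ac' /= sub0r mulrN1 addrNK.
  case=> x xr ax; apply: col; exists x => //; rewrite /recolor; case: eqP => //.
have [ji|ji] := eqVneq j i.
  exists J, (a \o f), b; case: (factor _ _ _ mab) => [|m <- col]; last by split.
  by apply: (reduce _ _ _ mab); rewrite // apE ac' ji.
have jr := col_neq_croot ca ac' c'r.
have pj : cpar j = i.
  by case: (col_par ca c'r ac'); rewrite pc' apE => -[] // /eqP; rewrite eq_sym (negbTE ji).
(* Path [i] ends at [p], where [c] is unmapped and [c'] starts path [j], so [j] is the only path
   following [i]. *)
have only k : (exists x, a x = Some k) -> k != croot J -> cpar k = cpar j -> k = j.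
  move=> uk kr pk; have apk : a p = Some (cpar k) by rewrite pk pj.
  have [||y [yr py ay]] := col_end_child ca _ pr _ uk kr apk.
  - by rewrite apE.
  - move=> z zr /(ch _ zr)[]->; rewrite ?ac ?ac' apE // => -[/eqP].
    by rewrite (negbTE ji).
  - by case: (ch _ yr py) => yE; move: ay; rewrite yE ?ac ?ac' // => -[].
(* Uniqueness carries over to [b], which uses the same colors, so the two paths can be concatenated
   in both trees. *)
have m0 : matching (J := collapse_tree jr) (omap (collapse j) \o a) (omap (collapse j) \o b).
  split.
  - apply: coloring_collapse; rewrite // ?pj // -?pj => x k ax; apply: only.
    by exists x.
  - apply: coloring_collapse; rewrite // ?pj // -?pj => x k bx; apply: only.
    by apply/ab; exists x.
  - move=> i0; split=> -[x] /=.
      case ax: (a x) => [k|] //= kE; have [y bY] := (ab k).1 (ex_intro _ x ax).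
      by exists y; rewrite bY.
    case bx: (b x) => [k|] //= kE; have [y ay] := (ab k).2 (ex_intro _ x bx).
    by exists y; rewrite ay.
exists (collapse_tree jr), (omap (collapse j) \o a \o f), (omap (collapse j) \o b).
case: (factor _ _ _ m0) => [|m -> col].
  apply: (reduce _ _ _ m0); rewrite /= ?ac // apE ac' /= /collapse eqxx pj.
  by rewrite eq_sym (negbTE ji).
split=> //; first exact: ccost_omap.
by case=> x xr ax; apply: col; exists x => //=; case: (a x) ax.
Qed.

(** Uncoloring a leaf may leave its color without vertices in [T]; dropping such colors restores a
    matching. Twice [wt c] is affordable, as deleting [c] afterwards saves one copy. *)
Lemma matching_erase T T2 c J (a : T -> option J) (b : T2 -> option J) :
  matching a b -> c != troot T -> leaf c ->
  exists (a' : T -> option J) (b' : T2 -> option J),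
    [/\ matching a' b', a' c = None & mcost a' b' <= mcost a b + wt c + wt c].
Proof.
move=> [ca cb _] cr /leafP lc.
have [x xr /(lc _ xr)//|u [m le]] := matching_keep (coloring_erase ca cr _) cb.
exists (keep u \o recolor a c None), (keep u \o b); split=> //.
  by rewrite /= /recolor eqxx.
apply: (le_trans le); apply: le_trans (ccost_recolor (a := a) (c := c) _ _ _ _) _.
- by move=> x xc; rewrite /recolor (negbTE xc).
- exact: wt_ge0.
rewrite lerD2r lerD2l -[leRHS]mulr1 ler_wpM2l ?wt_ge0 //.
by case: (a c) => [i|] /=; rewrite ?subr0 // sub0r; lra.
Qed.

Lemma iso_bij T T' E r l :
  iso_to T' [set: T]%SET E r l ->
  exists f : T' -> T, [/\ bijective f, f (troot T') = r,
        forall x y, edge x y = E (f x) (f y) &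
        forall x y, edge x y -> label (x, y) = l (f x, f y)].
Proof.
case=> f [f_inj fA fr fe fl]; exists f; split=> //; apply: inj_card_bij => //.
by rewrite -cardsT -fA; exact: leq_imset_card.
Qed.

(** The labels [l] may differ from those of [T], so that isomorphisms and relabelings are treated
    together. *)
Lemma iso_matching T T' T2 (l : T * T -> R) J (a : T' -> option J)
    (b : T2 -> option J) :
  iso_to T' [set: T]%SET (@edge _ T) (troot T) l -> matching a b ->
  exists a' : T -> option J, matching a' b /\
    mcost a' b <= mcost a b + \sum_(x | x != troot T) `|wt x - l (x, par x)|.
Proof.
move=> /iso_bij[f [f_bij fr fe fl]] mab; have f_inj := bij_inj f_bij.
have fpar y : y != troot T' -> f (par y) = par (f y).
  by move=> /edge_par; rewrite fe => /par_edge.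
have ctr := embedding_contraction f_inj fr fpar.
exists (obind a \o finv_opt f); split; first exact: matching_pull ctr mab.
have wE y : (@wt R T \o f) y = weight (@wt R T) (finv_opt f) (Some y).
  by rewrite /weight (big_pred1 (f y)) // => x; apply/eqP/eqP => /(finv_optP f_inj).
rewrite (ccost_pull _ _ _ wE) [weight _ _ None]big_pred0 ?addr0; last first.
  by move=> x; have [h _ hK] := f_bij; apply/eqP; rewrite ((finv_optP f_inj x (h x)).2 _).
apply: le_trans (ccost_reweight (@wt R T') _ _ _ _) _; rewrite lerD2l.
rewrite [leRHS](reindex f) /=; last exact: onW_bij.
rewrite [leLHS](bigD1 (troot T')) //= fr !wt_root subr0 normr0 add0r.
rewrite [leRHS](eq_bigl (fun y => y != troot T')); last first.
  by move=> y; rewrite -fr (inj_eq f_inj).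
apply: ler_sum => y yr; rewrite -fpar // -fl ?edge_par // label_wt ?edge_par //.
Qed.

Lemma matching_refl T :
  exists (J : color_tree) (a b : T -> option J), matching a b /\ mcost a b = 0.
Proof.
exists (vertex_colors T), Some, Some; split.
  by split; [exact: coloring_id|exact: coloring_id|].
rewrite /ccost big1 ?add0r; last by move=> i _; rewrite subrr normr0.
by rewrite /weight big_pred0 ?addr0.
Qed.

(** The identity matching of [T2] is pulled back through the operations, the last one first. *)
Lemma edit_sequence_matching T1 T2 (S : edit_sequence T2 T1) :
  exists (J : color_tree) (a : T1 -> option J) (b : T2 -> option J),
    matching a b /\ mcost a b <= seq_cost S.
Proof.
elim: S => [T iso|T T' o S [J [a [b [mab le]]]]] /=.
  have [J [a [b [mab le]]]] := matching_refl T2.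
  have [a' [mab' le']] := iso_matching iso mab; exists J, a', b; split=> //.
  rewrite le add0r in le'; apply: (le_trans le'); rewrite big1 // => x xr.
  by rewrite label_wt ?edge_par // subrr normr0.
case: o => [c p v [cp v0 iso]|c p dcp|c p dcp] /=.
- have [a' [mab' le']] := iso_matching iso mab; exists J, a', b; split=> //.
  rewrite addrC; apply: (le_trans le'); apply: lerD le _.
  rewrite (bigD1 c) ?(root_edge cp) //= (par_edge cp) eqxx label_wt //.
  rewrite big1 ?addr0 // => x /andP[xr xc]; rewrite xpair_eqE (negbTE xc) /=.
  by rewrite label_wt ?edge_par // subrr normr0.
- have [a' [mab' le']] := deletion_matching_pull dcp mab; exists J, a', b.
  by split=> //; rewrite le' addrC label_wt ?lerD2l //; case: dcp.
- have [cp lc _ _] := dcp.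
  (* For an insertion, uncoloring the new leaf costs up to twice its label, and removing it regains
     one copy. *)
  have [a1 [b1 [m1 a1c le1]]] := matching_erase mab (root_edge cp) lc.
  have [J2 [a2 [b2 [m2 le2 _]]]] := deletion_matching dcp m1 a1c.
  exists J2, a2, b2; split=> //; rewrite label_wt //; lra.
Qed.

End Matching.

(** * From matchings to edit sequences *)

Section TreeConstruction.
Variable R : realType.

(** The vertices are the elements of the subtype given by [A]; [q] supplies the parents, and the
    measure [d], decreasing along [q], connects every vertex to [r]. *)
Lemma subtree_exists (V : finType) (A : {set V}) (E : rel V) (r : V)
    (l : V * V -> R) (q : V -> V) (d : V -> nat) :
  r \in A ->
  {in A, forall x, x != r -> q x \in A /\ (d (q x) < d x)%N} ->
  {in A &, forall x y, E x y = (x != r) && (y == q x)} ->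
  #|[set x in A | E x r]%SET| = 1%N ->
  {in A, forall v, v != r -> #|[set x in A | E x v]%SET| <> 1%N} ->
  {in A &, forall x y, E x y -> 0 < l (x, y)} ->
  exists T' : merge_tree R, iso_to T' A E r l.
Proof.
move=> rA qA EA deg_r deg_v l_gt0.
pose W := {x : V | x \in A}.
pose mk x (xA : x \in A) : W := exist (fun x => is_true (x \in A)) x xA.
pose r' : W := mk r rA.
pose e : rel W := fun x y => E (val x) (val y).
have eE x y : e x y = (x != r') && (val y == q (val x)).
  by rewrite /e EA ?(valP x) ?(valP y) // -val_eqE.
have cardE v : #|children e v| = #|[set x in A | E x (val v)]%SET|.
  rewrite -(card_imset _ val_inj); congr (#|pred_of_set _|).
  apply/finset.setP => x; rewrite !inE; apply/imsetP/andP => [[y]|[xA Ex]].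
    by rewrite inE => ey ->; split=> //; exact: valP.
  by exists (mk x xA); rewrite ?inE.
have e_tree : rooted_tree e r'.
  split.
  - move=> y; rewrite /e EA ?(valP y) //= eqxx //.
  - move=> x xr; have [qxA _] := qA _ (valP x) xr.
    exists (mk _ qxA); split=> [|y]; first by rewrite eE xr /=.
    by rewrite eE xr => /eqP yq; apply: val_inj; rewrite /= yq.
  - move=> x; have [n] := ubnP (d (val x)); elim: n x => // n IHn x dx.
    have [->|xr] := eqVneq x r'; first exact: connect0.
    have [qxA dq] := qA _ (valP x) xr.
    apply: (@connect_trans _ _ (mk _ qxA)); first by apply: connect1; rewrite eE xr /=.
    by apply: IHn; exact: leq_trans dq _.
have dr : #|children e r'| = 1%N by rewrite cardE.
have dv v : v != r' -> #|children e v| <> 1%N.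
  by move=> vr; rewrite cardE; apply: deg_v (valP v) vr.
have lg c p : e c p -> 0 < l (val c, val p) by apply: l_gt0; exact: valP.
exists (@MergeTree R W e r' (fun x => l (val x.1, val x.2)) e_tree dr dv lg).
exists val; split=> //; first exact: val_inj.
apply/finset.setP => x; apply/imsetP/idP => [[y _ ->]|xA]; first exact: valP.
by exists (mk x xA).
Qed.

Lemma deletion_exists (T : merge_tree R) (c p : T) :
  edge c p -> leaf c -> p != troot T -> exists T', deletion c p T'.
Proof.
move=> cp cl pr; have lc := (leafP c).1 cl; have cr := root_edge cp.
have pcp := par_edge cp.
have ch v : children (@edge _ T) v = [set x | edge x v]%SET by [].
have [/eqP/cards1P[c' chp]|ch1] := eqVneq #|children (@edge _ T) p :\ c| 1%N; last first.
  have [||||||T' iso] := @subtree_exists T [set~ c]%SET (@edge _ T) (troot T)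
      (@label _ T) (@par R T) (@depth R T).
  - by rewrite !inE eq_sym.
  - move=> x; rewrite !inE => xc xr; split; last by rewrite (depth_par xr).
    exact/eqP/lc.
  - by move=> x y _ _; rewrite edgeE.
  - rewrite -(deg_root T); congr (#|pred_of_set _|); apply/finset.setP => x.
    by rewrite !inE; case: eqP => //= ->; rewrite edgeE pcp (eq_sym _ p) (negbTE pr) andbF.
  - move=> v _ vr; have [->|vp] := eqVneq v p.
      move/eqP: ch1 => ch1 E; apply: ch1; rewrite -[RHS]E; congr (#|pred_of_set _|).
      by apply/finset.setP => x; rewrite !inE.
    move=> E; apply: (deg_nonroot vr); rewrite -[RHS]E; congr (#|pred_of_set _|).
    apply/finset.setP => x; rewrite !inE; case: eqP => //= ->.
    by rewrite edgeE pcp (negbTE vp) andbF.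
  - by move=> x y _ _; exact: label_gt0.
  by exists T'; split=> //; left; split=> //; exact/eqP.
have c'P x : edge x p = (x == c) || (x == c').
  have /finset.setP/(_ x) := chp; rewrite !inE; case: eqVneq => [->|_] /=; rewrite ?cp //.
have c'p : edge c' p by rewrite c'P eqxx orbT.
have [c'r pc'] := (root_edge c'p, par_edge c'p).
have c'c : c' != c by have /finset.setP/(_ c') := chp; rewrite !inE eqxx => /andP[].
have c'np : c' != p by rewrite -pc' eq_sym par_neq.
pose p' := par p; have pp' : edge p p' := edge_par pr.
have p'p : p' != p := par_neq pr.
have p'c : p' != c by apply/eqP/lc.
pose E x y := edge x y || ((x, y) == (c', p')).
pose l (e : T * T) := if e == (c', p') then label (c', p) + label (p, p') else label e.
have rA : troot T \in (~: [set c; p])%SET.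
  by rewrite !inE negb_or !(eq_sym (troot T)) cr pr.
(* Contracting [p] preserves degrees: children change only at [p'], where [c'] takes the place of
   [p]. *)
have degE v : v \in (~: [set c; p])%SET ->
    #|[set x in ~: [set c; p] | E x v]%SET| = #|children (@edge _ T) v|.
  rewrite !inE negb_or => /andP[vc vp].
  have [->|vp'] := eqVneq v p'; last first.
    congr (#|pred_of_set _|); apply/finset.setP => x; rewrite !inE negb_or /E xpair_eqE.
    rewrite (negbTE vp') andbF orbF edgeE.
    case: (eqVneq x c) => [->|_] /=; first by rewrite cr pcp (negbTE vp).
    by case: (eqVneq x p) => [->|_] //=; rewrite pr -/p' (negbTE vp').
  rewrite [RHS](cardsD1 p) inE pp'.
  rewrite (cardsD1 c') !inE negb_or c'c c'np /E eqxx orbT /=; congr (_.+1).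
  congr (#|pred_of_set _|); apply/finset.setP => x; rewrite !inE negb_or xpair_eqE eqxx andbT.
  case: (eqVneq x c') => [->|_] /=; first by rewrite edgeE pc' (negbTE p'p) !andbF.
  by rewrite orbF; case: (eqVneq x c) => [->|_] //=; rewrite edgeE pcp (negbTE p'p) !andbF.
have [||||||T' iso] := @subtree_exists T (~: [set c; p])%SET E (troot T)
    l (fun x => if x == c' then p' else par x) (@depth R T).
- exact: rA.
- move=> x; rewrite !inE !negb_or => /andP[xc xp] xr; case: (eqVneq x c') => [->|xc'].
    by rewrite p'p p'c (depth_par c'r) pc' (depth_par pr).
  rewrite (depth_par xr) ltnSn; split=> //.
  apply/andP; split; first exact/eqP/lc.
  apply/eqP => px; have := edge_par xr; rewrite px c'P.
  by rewrite (negbTE xc) (negbTE xc').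
- move=> x y; rewrite !inE !negb_or => /andP[xc xp] /andP[yc yp].
  rewrite /E xpair_eqE edgeE; case: (eqVneq x c') => [->|_] /=.
    by rewrite c'r pc' (negbTE yp).
  by rewrite orbF.
- by rewrite (degE _ rA) deg_root.
- by move=> v vA vr; rewrite (degE _ vA); exact: deg_nonroot.
- move=> x y _ _; rewrite /E /l; case: eqP => [_ _|_]; last by rewrite orbF; exact: label_gt0.
  by rewrite addr_gt0 ?label_gt0.
exists T'; split=> //; right; exists c', p'; split=> //.
Qed.

End TreeConstruction.

(** * Edit sequences realizing a matching *)

Section EditSequences.
Variable R : realType.
Implicit Types (T : merge_tree R) (J : color_tree).

Lemma isomorphic_refl T : isomorphic T T.
Proof.
exists id; split=> //; apply/finset.setP => x; rewrite inE.
by apply/imsetP; exists x.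
Qed.

Lemma iso_to_comp T T' (V : finType) (A : {set V}) E r l :
  isomorphic T T' -> iso_to T' A E r l -> iso_to T A E r l.
Proof.
move=> /iso_bij[f [[h fK hK] fr fe fl]] [k [k_inj kA kr ke kl]].
have h_inj : injective h := can_inj hK.
exists (k \o h); split.
- exact: inj_comp.
- rewrite -kA; apply/finset.setP => x; apply/imsetP/imsetP => -[y _ ->].
    by exists (h y).
  by exists (f y) => //=; rewrite fK.
- by rewrite /= -fr fK.
- by move=> x y /=; rewrite -ke fe !hK.
- move=> x y xy /=; have hxy : edge (h x) (h y) by rewrite fe !hK.
  by rewrite -kl // fl // !hK.
Qed.

(** Sequences grow at the front, so an insertion at the end is added by induction; at the empty
    sequence, the deletion is carried over to the isomorphic tree. *)
Lemma edit_sequence_insert T T1 T2 (c p : T2) (S : edit_sequence T T1) :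
  deletion c p T ->
  exists S' : edit_sequence T2 T1, seq_cost S' = seq_cost S + label (c, p).
Proof.
elim: S => [T0 iso|T0 T' o S IHS] dcp /=.
  have dcp0 : deletion c p T0.
    case: dcp => cp cl pr [[n1 i1]|[c' [p' [ch pp' i1]]]]; split=> //.
      by left; split=> //; exact: iso_to_comp i1.
    by right; exists c', p'; split=> //; exact: iso_to_comp i1.
  exists (EditCons (Insert dcp0) (EditNil (isomorphic_refl T2))).
  by rewrite /= addrC.
by have [S' S'E] := IHS dcp; exists (EditCons o S'); rewrite /= S'E addrA.
Qed.

(** The new tree is given explicitly, on the vertices and edges of [T], so that maps out of [T] can
    be used unchanged. *)
Lemma relabel_exists T (c p : T) (v : R) :
  edge c p -> 0 < v ->
  exists lg : (forall x y : T, edge x y ->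
      0 < (fun e => if e == (c, p) then v else label e) (x, y)),
    relabeling c p v (MergeTree (edge_tree T) (deg_root T) (@deg_nonroot _ T) lg).
Proof.
move=> cp v0.
have lg (x y : T) : edge x y ->
    0 < (fun e => if e == (c, p) then v else label e) (x, y).
  by case: ifP => // _; exact: label_gt0.
exists lg; split=> //; exists id; split=> //; apply/finset.setP => x; rewrite inE.
by apply/imsetP; exists x.
Qed.

(** Induction on the number of vertices with wrong weight, each of which is relabeled once. *)
Lemma relabel_sequence T1 T2 (f : T1 -> T2) :
  bijective f -> (forall x, f (par x) = par (f x)) -> f (troot T1) = troot T2 ->
  exists S : edit_sequence T2 T1,
    seq_cost S <= \sum_(x | x != troot T1) `|wt x - wt (f x)|.
Proof.
have [n] := ubnP #|[set x : T1 | wt x != wt (f x)]%SET|.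
elim: n T1 f => // n IHn T1 f ltn f_bij fpar fr; have [h fK hK] := f_bij.
have f_inj := can_inj fK; have h_inj := can_inj hK.
have feq x : (f x == troot T2) = (x == troot T1) by rewrite -fr (inj_eq f_inj).
have fe x y : edge (f x) (f y) = edge x y.
  by rewrite !edgeE feq -fpar (inj_eq f_inj).
have [/eqP|] := set_0Vmem [set x : T1 | wt x != wt (f x)]%SET.
  rewrite -cards_eq0 cards_eq0 => /eqP/finset.setP wE.
  have iso : isomorphic T1 T2.
    exists h; split.
    - exact: h_inj.
    - apply/finset.setP => x; rewrite inE; apply/imsetP.
      by exists (f x).
    - by rewrite -fr fK.
    - by move=> x y; rewrite -fe !hK.
    - move=> x y xy; have hxy : edge (h x) (h y) by rewrite -fe !hK.
      have := wE (h x); rewrite !inE => /negbFE/eqP.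
      by rewrite (label_wt xy) (label_wt hxy) hK => ->.
  by exists (EditNil iso) => /=; apply: sumr_ge0 => x _.
move=> [c]; rewrite inE => wc.
have cr : c != troot T1.
  by apply: contraNneq wc => ->; rewrite fr !wt_root.
have v0 : 0 < wt (f c) by rewrite wt_gt0 ?feq.
have [lg rel] := relabel_exists (edge_par cr) v0.
set T' := MergeTree _ _ _ lg in rel.
have wt'E (x : T1) : @wt R T' x = if x == c then wt (f c) else wt x.
  rewrite {1}/wt /= -[@par R T' x]/(@par R T1 x) xpair_eqE.
  case: (eqVneq x c) => [->|xc] /=; first by rewrite eqxx (negbTE cr).
  by rewrite /wt.
have [|S leS] := IHn T' f _ f_bij fpar fr.
  apply: leq_trans (_ : #|[set x : T1 | wt x != wt (f x)]| <= n)%N; last by rewrite -ltnS.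
  apply: proper_card; apply/properP; split.
    apply/fintype.subsetP => x; rewrite !inE wt'E.
    by case: (eqVneq x c) => [->|//]; rewrite eqxx.
  by exists c; rewrite !inE // wt'E !eqxx.
exists (EditCons (Relabel rel) S) => /=.
rewrite (bigD1 c) //= (label_wt (edge_par cr)) lerD2l; apply: (le_trans leS).
rewrite (bigD1 c) //= wt'E eqxx subrr normr0 add0r; apply: ler_sum => x /andP[_ xc].
by rewrite wt'E (negbTE xc).
Qed.

(** A deepest uncolored vertex is a leaf. Its edge is not the root edge, because the latter lies
    above every colored vertex and is thus colored. *)
Lemma col_None_leaf T J (a : T -> option J) x :
  coloring a -> colored a -> a x = None ->
  exists c, [/\ a c = None, leaf c, c != troot T & par c != troot T].
Proof.
move=> ca [y yr ay] ax.
case: (@arg_maxnP T x (fun z => a z == None) (@depth R T)) => [|c /eqP ac cmax].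
  exact/eqP.
have cr : c != troot T by apply: contra_eq_neq ac => ->; rewrite (col_root ca).
exists c; split=> //.
  apply/leafP => z zr pz; have : a z == None.
    by case az: (a z) => //; case: (@col_par_Some _ _ _ _ z ca); rewrite ?az ?pz.
  by move=> /cmax /=; rewrite /geq /= leqNgt (depth_par zr) pz ltnSn.
apply/eqP => pc.
have {y yr ay} [y [yr ay py]] : exists y, [/\ y != troot T, a y <> None & par y = troot T].
  elim/depth_ind: y yr ay => y IHy yr ay.
  have [py|py] := eqVneq (par y) (troot T); first by exists y.
  by apply: IHy => //; exact: col_par_Some.
have [b _ bP] := root_childP T.
by apply: ay; rewrite (bP y yr py) -(bP c cr pc).
Qed.

Lemma deletion_card T T' (c p : T) : deletion c p T' -> (#|T'| < #|T|)%N.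
Proof.
move=> /deletion_contraction[f [g [ctr _ gN _]]].
have f_inj : injective f by move=> x y xy; apply: Some_inj; rewrite -!(ctr_fK ctr) xy.
rewrite -(card_imset _ f_inj) -[X in (_ < X)%N]cardsT; apply: proper_card.
apply/properP; split; first exact: finset.subsetT.
exists c; rewrite ?inE //; apply/imsetP => -[y _ cy].
by have := ctr_fK ctr y; rewrite -cy (gN c).2.
Qed.

(** A path with two edges has an inner vertex, which has another child; by [col_sib] the edge of
    that child would be unmapped. *)
Lemma col_full_inj T J (a : T -> option J) :
  coloring a -> (forall x, a x <> None) -> injective a.
Proof.
move=> ca full.
have top x : x != troot T -> a (par x) <> a x.
  move=> xr apx; case ax: (a x) => [i|]; last exact: full ax.
  have pr : par x != troot T.
    by apply: contraNneq xr => px; apply/eqP; apply: (col_rootP ca); rewrite -(col_root ca) -px.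
  have [z [zr zx pz]] := siblingP xr pr.
  by apply: (full z); apply: (col_sib ca xr zr _ (esym pz) ax); rewrite ?apx // eq_sym.
move=> x y axy; case ax: (a x) => [i|]; last by case: (full x).
have ay : a y = Some i by rewrite -axy.
have [xr|xr] := eqVneq x (troot T).
  by rewrite xr; apply/esym/(col_rootP ca); rewrite ay -ax xr (col_root ca).
have ir := col_neq_croot ca ax xr; have yr := col_neq_root ca ay ir.
by apply: (col_top ca xr yr ax ay); [rewrite -ax|rewrite -ay]; exact: top.
Qed.

(** Both colorings are injective, so [f] can send each vertex to the one of the same color. *)
Lemma full_matching_bij T1 T2 J (a : T1 -> option J) (b : T2 -> option J) :
  matching a b -> (forall x, a x <> None) -> (forall y, b y <> None) ->
  exists f : T1 -> T2,
    [/\ bijective f, forall x, f (par x) = par (f x), f (troot T1) = troot T2 &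
        \sum_(x | x != troot T1) `|wt x - wt (f x)| <= mcost a b].
Proof.
move=> [ca cb ab] fa fb.
have a_inj := col_full_inj ca fa; have b_inj := col_full_inj cb fb.
have /boolp.choice[f fE] x : exists y, b y = a x.
  case ax: (a x) => [i|]; last by case: (fa x).
  by have [y <-] := (ab i).1 (ex_intro _ x ax); exists y.
have /boolp.choice[h hE] y : exists x, a x = b y.
  case bY: (b y) => [i|]; last by case: (fb y).
  by have [x <-] := (ab i).2 (ex_intro _ y bY); exists x.
have fr : f (troot T1) = troot T2.
  by apply: b_inj; rewrite fE (col_root ca) (col_root cb).
have par_col T (d : T -> option J) x i : coloring d -> injective d ->
    x != troot T -> d x = Some i -> d (par x) = Some (cpar i).
  move=> cd d_inj xr dx; case: (col_par cd xr dx) => //; rewrite -dx => /d_inj/eqP.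
  by rewrite (negbTE (par_neq xr)).
exists f; split=> //.
- by exists h => x; [apply: a_inj|apply: b_inj]; rewrite ?hE ?fE ?hE.
- move=> x; have [->|xr] := eqVneq x (troot T1); first by rewrite par_root fr par_root.
  case ax: (a x) => [i|]; last by case: (fa x).
  have bfx : b (f x) = Some i by rewrite fE.
  apply: (b_inj); rewrite fE (par_col _ _ _ _ ca a_inj xr ax).
  by rewrite (par_col _ _ _ _ cb b_inj (col_neq_root cb bfx (col_neq_croot ca ax xr)) bfx).
have w1 T (d : T -> option J) x : injective d -> weight (@wt R T) d (d x) = wt x.
  move=> d_inj; rewrite /weight (big_pred1 x) // => y.
  by apply/eqP/eqP => [/d_inj|->].
have /boolp.choice[k kE] x : exists i, a x = Some i.
  by case ax: (a x) => [i|]; [exists i|case: (fa x)].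
have k_inj : injective k by move=> x y kxy; apply: a_inj; rewrite !kE kxy.
apply: (@le_trans _ _ (\sum_i
  `|weight (@wt R T1) a (Some i) - weight (@wt R T2) b (Some i)|)); last first.
  by rewrite /ccost -addrA lerDl addr_ge0 // weight_ge0 //; exact: wt_ge0.
apply: (@le_trans _ _ (\sum_x `|wt x - wt (f x)|)).
  by rewrite [leRHS](bigID (fun x => x != troot T1)) /= lerDl sumr_ge0.
(* [k] lists the used colors without repetition; all others contribute nonnegative terms. *)
rewrite [leRHS](bigID (fun i => i \in [set k x | x : T1]%SET)) /= big_imset /=; last first.
  by move=> x y _ _; exact: k_inj.
rewrite -[leLHS]addr0; apply: lerD; last by rewrite sumr_ge0.
by apply: ler_sum => x _; rewrite -kE (w1 _ _ _ a_inj) -fE (w1 _ _ _ b_inj).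
Qed.

(** Induction on the total number of vertices; each unmapped edge gives a smaller pair of trees. *)
Lemma matching_edit_sequence T1 T2 J (a : T1 -> option J) (b : T2 -> option J) :
  matching a b -> colored a ->
  exists S : edit_sequence T2 T1, seq_cost S <= mcost a b.
Proof.
have [n] := ubnP (#|T1| + #|T2|); elim: n T1 T2 J a b => // n IHn T1 T2 J a b.
rewrite ltnS => len mab col; have [ca cb _] := mab; have mba := matchingC mab.
have colb := matching_colored mab col.
case: (pselect (exists x, a x = None)) => [[x ax]|fa].
  have [c [ac lc cr pr]] := col_None_leaf ca col ax.
  have [T' dcp] := deletion_exists (edge_par cr) lc pr.
  have [J' [a' [b' [mab' le' col']]]] := deletion_matching dcp mab ac.
  have [|S leS] := IHn _ _ _ _ _ _ mab' (col' col).
    by apply: leq_trans len; rewrite ltn_add2r; exact: deletion_card dcp.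
  exists (EditCons (Delete dcp) S) => /=; rewrite label_wt ?edge_par // addrC.
  by apply: le_trans le'; rewrite lerD2r.
(* An unmapped edge of [T2] is deleted there, and its insertion is appended to the sequence leading
   to the smaller tree. *)
case: (pselect (exists y, b y = None)) => [[y bY]|fb].
  have [c [bc lc cr pr]] := col_None_leaf cb colb bY.
  have [T' dcp] := deletion_exists (edge_par cr) lc pr.
  have [J' [b' [a' [mba' le' col']]]] := deletion_matching dcp mba bc.
  have mab' := matchingC mba'.
  have [|S leS] := IHn _ _ _ _ _ _ mab' (matching_colored mba' (col' colb)).
    by apply: leq_trans len; rewrite ltn_add2l; exact: deletion_card dcp.
  have [S' S'E] := edit_sequence_insert S dcp.
  exists S'; rewrite S'E label_wt ?edge_par // (ccostC _ a).
  by apply: le_trans le'; rewrite lerD2r ccostC.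
have [x ax|y bY|f [f_bij fpar fr le]] := full_matching_bij mab.
- by apply: fa; exists x.
- by apply: fb; exists y.
have [S leS] := relabel_sequence f_bij fpar fr.
by exists S; exact: le_trans le.
Qed.

End EditSequences.

(** * Path mappings and matchings *)

Section Paths.
Variables (R : realType) (T : merge_tree R).
Implicit Types (x y z : T) (s : seq T).

Let down := fun x y : T => edge y x.

Lemma is_pathP s :
  is_path s -> exists x y t, s = [:: x, y & t] /\ path down x (y :: t).
Proof. by case: s => [|x [|y t]] //= /andP[_ st]; exists x, y, t. Qed.

(** Each vertex of a path but the first stands for the edge above it, so [behead s] encodes the
    edges of [s]. *)
Lemma path_edgesE s : is_path s -> path_edges s = [seq (x, par x) | x <- behead s].
Proof.
move=> /is_pathP[x [y [t [->]]]]; rewrite /path_edges [behead _]/=.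
elim: (y :: t) x => {y t} [|y t IHt] x // /andP[yx /IHt E].
by rewrite map_cons (par_edge yx) -E.
Qed.

Lemma path_depth_sorted s : is_path s -> sorted ltn (map (@depth R T) s).
Proof.
move=> /is_pathP[x [y [t [->]]]].
rewrite -[sorted _ _]/(path ltn (depth x) (map (@depth R T) (y :: t))).
elim: (y :: t) x => {y t} [|y t IHt] x //= /andP[yx /IHt ->].
by rewrite (depth_par (root_edge yx)) (par_edge yx) ltnSn.
Qed.

Lemma path_depth_inj s : is_path s -> {in s &, injective (@depth R T)}.
Proof.
move=> /path_depth_sorted/(sorted_uniq ltn_trans ltnn) us x y xs ys.
apply: contra_eq => xy; move: us.
case/splitPr: xs ys xy => s1 s2; rewrite map_cat cat_uniq /= mem_cat inE.
move=> /orP[ys|/orP[/eqP->|ys]] xy; last 1 first.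
- move=> /and3P[_ _ /andP[xs2 _]]; apply: contraNneq xs2 => ->; exact: map_f.
- move=> /and3P[_ + _]; apply: contraNneq => ->.
  by rewrite (map_f (@depth R T) ys).
- by rewrite eqxx in xy.
Qed.

Lemma path_uniq s : is_path s -> uniq s.
Proof.
by move=> /path_depth_sorted/(sorted_uniq ltn_trans ltnn); exact: map_uniq.
Qed.

Lemma path_behead s x : is_path s -> x \in behead s ->
  [/\ x != troot T, x \in s, par x \in s & par x = path_start s \/ par x \in behead s].
Proof.
move=> /is_pathP[y0 [y [t [->]]]]; rewrite /path_start [behead _]/= [head _ _]/=.
elim: (y :: t) y0 => {y t} [|y t IHt] y0 //= /andP[yx pt]; rewrite inE => /orP[/eqP->|xt].
  rewrite (par_edge yx) !inE !eqxx orbT; split=> //; last by left.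
  exact: root_edge yx.
have [xr _ _ px] := IHt _ pt xt.
rewrite !inE xt !orbT xr; split=> //; case: px => [->|->]; rewrite ?eqxx ?orbT //.
  by right.
by right.
Qed.

Lemma path_end_mem s : is_path s -> path_end s \in behead s.
Proof. by move=> /is_pathP[x [y [t [-> _]]]]; rewrite /path_end /= mem_last. Qed.

Lemma path_memE s x : is_path s -> x \in s -> x = path_start s \/ x \in behead s.
Proof.
by move=> /is_pathP[y [z [t [-> _]]]]; rewrite inE => /orP[/eqP->|]; [left|right].
Qed.

Lemma path_startN s : is_path s -> path_start s \notin behead s.
Proof.
by move=> /[dup]/path_uniq us /is_pathP[y [z [t [sE _]]]]; move: us; rewrite sE => /andP[].
Qed.

Lemma path_top s : is_path s -> exists2 x, x \in behead s & par x = path_start s.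
Proof.
move=> /is_pathP[y [z [t [-> /andP[zy _]]]]]; exists z; first by rewrite inE eqxx.
exact: par_edge zy.
Qed.

Lemma path_next s x : is_path s -> x \in s -> x <> path_end s ->
  exists2 z, z \in behead s & par z = x.
Proof.
move=> /is_pathP[y0 [y [t [->]]]]; rewrite /path_end [behead _]/=.
elim: (y :: t) y0 => {y t} [|y t IHt] y0 /=; first by rewrite inE => _ /eqP.
move=> /andP[yx pt]; rewrite inE => /orP[/eqP-> _|xt xl].
  by exists y; [rewrite inE eqxx|exact: par_edge yx].
by have [z zt pz] := IHt _ pt xt xl; exists z; rewrite // inE zt orbT.
Qed.

Lemma path_behead_inj s : is_path s -> {in behead s &, injective (@par R T)}.
Proof.
move=> ps x y xs ys pxy; have [xr xs' _ _] := path_behead ps xs.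
have [yr ys' _ _] := path_behead ps ys.
by apply: (path_depth_inj ps xs' ys'); rewrite (depth_par xr) (depth_par yr) pxy.
Qed.

Lemma path_depth_end s x : is_path s -> x \in s -> (depth x <= depth (path_end s))%N.
Proof.
move=> /path_depth_sorted st xs; rewrite /path_end.
case/splitPr: xs st => s1 s2; rewrite last_cat map_cat => /cat_sorted2[_] /=.
elim: s2 x {s1} => //= y s2 IHs x /andP[xy /IHs]; exact: leq_trans (ltnW xy).
Qed.

Lemma path_depth_start s x :
  is_path s -> x \in behead s -> (depth (path_start s) < depth x)%N.
Proof.
move=> ps; elim/depth_ind: x => x IHx xs.
have [xr _ _ [<-|pxs]] := path_behead ps xs; first by rewrite (depth_par xr).
by apply: (ltn_trans (IHx xr pxs)); rewrite (depth_par xr).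
Qed.

Lemma path_labelE s : is_path s -> path_label s = \sum_(x | x \in behead s) wt x.
Proof.
move=> ps; rewrite /path_label path_edgesE // big_map.
have ub : uniq (behead s).
  by move: (path_uniq ps); case: (s) => //= x t /andP[].
rewrite -(big_uniq _ ub) /= !big_seq; apply: eq_bigr => x xs.
by have [xr _ _ _] := path_behead ps xs; rewrite label_wt ?edge_par.
Qed.

Lemma sum_edges (Q : pred (T * T)) :
  \sum_(e in [set e : T * T | edge e.1 e.2 & Q e]%SET) label e =
  \sum_(x | (x != troot T) && Q (x, par x)) wt x.
Proof.
rewrite big_mkcond /= (eq_bigr (fun e : T * T =>
  if (e.1 != troot T) && (e.2 == par e.1) && Q (e.1, e.2)
  then label (e.1, e.2) else 0)); last by case=> x y _; rewrite !inE edgeE.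
rewrite -(pair_bigA _ (fun x y => if (x != troot T) && (y == par x) && Q (x, y)
  then label (x, y) else 0)) /= [RHS]big_mkcond; apply: eq_bigr => x _.
rewrite (bigD1 (par x)) //= eqxx andbT big1 ?addr0.
  by case: ifP => // /andP[xr _]; rewrite label_wt ?edge_par.
by move=> y /negbTE->; rewrite andbF.
Qed.

End Paths.

(** * Colorings from families of paths *)

Section PathFamily.
Variables (R : realType) (T : merge_tree R) (I : finType).
Variables (P : I -> seq T) (pi : I -> option I).
Variables (rk : option I -> nat).
Hypothesis rkP : forall i, i != None -> (rk (obind pi i) < rk i)%N.
Hypothesis pathP : forall i, is_path (P i).
Hypothesis meetP : forall i j, i <> j -> (#|path_meet (P i) (P j)| <= 1)%N.
Hypothesis startP : forall i,
  path_start (P i) = if pi i is Some j then path_end (P j) else troot T.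

(** The root color [None] is added to the indices of the paths; [pi] gives the path that a given
    path continues, if any. *)
Definition family_tree : color_tree := ColorTree rkP.

Definition family_color (x : T) : option family_tree :=
  if x == troot T then Some None
  else omap Some [pick i | x \in behead (P i)].

Lemma meet_uniq i j x y : x != y -> x \in P i -> y \in P i ->
  x \in P j -> y \in P j -> i = j.
Proof.
move=> xy xi yi xj yj; apply/eqP; apply: contraT => /eqP/meetP.
move/card_le1P/(_ x); rewrite !inE xi xj => /(_ isT y).
by rewrite !inE yi yj eq_sym (negbTE xy).
Qed.

(** Adjacent vertices are distinct, so sharing an edge means meeting twice. *)
Lemma behead_uniq i j x : x \in behead (P i) -> x \in P j -> par x \in P j -> i = j.
Proof.
move=> xi xj pxj; have [xr xi' pxi _] := path_behead (pathP i) xi.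
exact: meet_uniq (par_neq xr) pxi xi' pxj xj.
Qed.

Lemma family_colorP x i : family_color x = Some (Some i) <-> x \in behead (P i).
Proof.
rewrite /family_color; case: eqVneq => [->|xr].
  split=> // /(path_behead (pathP i))[]; by rewrite eqxx.
case: pickP => [j xj|nj] /=; last by rewrite nj.
split=> [[<-]//|xi]; have [_ xi' pxi _] := path_behead (pathP i) xi.
by rewrite (behead_uniq xj xi' pxi).
Qed.

Lemma family_color_root x : family_color x = Some None <-> x = troot T.
Proof.
rewrite /family_color; case: eqP => [//|xr]; split=> //.
by case: pickP.
Qed.

Lemma family_color_None x :
  family_color x = None <-> x != troot T /\ forall i, x \notin behead (P i).
Proof.
split=> [xN|[xr xN]].
  split; first by apply: contra_eq_neq xN => ->; rewrite (family_color_root _).2.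
  by move=> i; apply/negP => /family_colorP; rewrite xN.
case E: (family_color x) => [[i|]|] //.
  by move/family_colorP: E; rewrite (negbTE (xN i)).
by move/family_color_root: E xr => ->; rewrite eqxx.
Qed.

Lemma coloring_family : coloring family_color.
Proof.
have endP i : path_end (P i) \in behead (P i) by apply: path_end_mem.
have notroot x i : x != troot T -> family_color x = Some i ->
      exists j, i = Some j /\ x \in behead (P j).
  move=> xr; case: i => [j|/family_color_root xE]; last by rewrite xE eqxx in xr.
  by move=> /family_colorP xj; exists j.
have rootN i : troot T \notin behead (P i).
  by apply/negP => /(path_behead (pathP i))[]; rewrite eqxx.
split.
- exact/family_color_root.
- by move=> x /family_color_root.
- move=> x i xr /(notroot _ _ xr)[j [-> xj]].
  have [_ _ _ [pxj|pxj]] := path_behead (pathP j) xj; last by left; exact/family_colorP.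
  right; rewrite pxj startP /=; case: (pi j) => [k|]; last exact/family_color_root.
  exact/family_colorP.
(* A path [k] using the edge above [z] would start at the inner vertex [par x] of path [j]. It would
   then continue a path [l] ending there, which must be [j]; but [j] goes on to [x]. *)
- move=> x z i xr zr xz pxz /(notroot _ _ xr)[j [-> xj]] /family_colorP pxj.
  apply/family_color_None; split=> // k; apply/negP => zk.
  have [_ _ pzk pzk'] := path_behead (pathP k) zk.
  have kj : k <> j.
    by move=> kj; case/eqP: xz; apply: (path_behead_inj (pathP j)) => //; rewrite -kj.
  case: pzk' => [pzk'|]; last first.
    rewrite -pxz => pxk; apply: kj; have [_ ? ? _] := path_behead (pathP j) pxj.
    exact: behead_uniq pxk _ _.
  move: (startP k); rewrite -pzk' -pxz; case: (pi k) => [l|] pxE; last first.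
    by rewrite pxE (negbTE (rootN j)) in pxj.
  have [_ pxj1 pxj2 _] := path_behead (pathP j) pxj.
  have lj : l = j by apply: (@behead_uniq l j (par x)); rewrite // pxE.
  have [_ xj' _ _] := path_behead (pathP j) xj.
  have := path_depth_end (pathP j) xj'.
  by rewrite -lj -pxE (depth_par xr) ltnn.
- move=> x z i xr zr /(notroot _ _ xr)[j [-> xj]] /family_colorP zj npx npz.
  have topE y : y \in behead (P j) -> family_color (par y) <> Some (Some j) ->
      par y = path_start (P j).
    move=> yj npy; have [_ _ _ [//|pyj]] := path_behead (pathP j) yj.
    by case: npy; exact/family_colorP.
  exact: (path_behead_inj (pathP j) xj zj (etrans (topE x xj npx) (esym (topE z zj npz)))).
Qed.

Lemma weight_family i :
  weight (@wt R T) family_color (Some (Some i)) = path_label (P i).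
Proof.
rewrite path_labelE // /weight; apply: eq_bigl => x.
by apply/eqP/idP => /family_colorP.
Qed.

Lemma weight_family_root : weight (@wt R T) family_color (Some None) = 0.
Proof.
by apply: big1 => x /eqP/family_color_root ->; exact: wt_root.
Qed.

Lemma weight_family_None :
  weight (@wt R T) family_color None =
  \sum_(e in [set e : T * T | edge e.1 e.2 & [forall i, e \notin path_edges (P i)]]%SET)
    label e.
Proof.
rewrite (sum_edges (fun e => [forall i, e \notin path_edges (P i)])) /weight.
apply: eq_bigl => x; apply/eqP/andP => [/family_color_None[xr xN]|[xr /forallP xN]].
  split=> //; apply/forallP => i; rewrite path_edgesE //.
  by apply/mapP => -[y yi [xy _]]; rewrite -xy (negbTE (xN i)) in yi.
apply/family_color_None; split=> // i; apply: contra (xN i) => xi.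
by rewrite path_edgesE //; apply/mapP; exists x.
Qed.

End PathFamily.

(** * Paths from color classes *)

Section ColorPaths.
Variables (R : realType) (T : merge_tree R) (J : color_tree) (a : T -> option J).
Hypothesis ca : coloring a.

Lemma color_path i : i != croot J -> (exists x, a x = Some i) ->
  exists s, is_path s /\ forall x, x \in behead s <-> a x = Some i.
Proof.
move=> ir [x ax].
(* Climbing from [y] to the first edge of its class gives a path ending at [y]. *)
have build y : a y = Some i -> exists s, [/\ is_path s, path_end s = y,
    forall z, z \in behead s -> a z = Some i & a (path_start s) <> Some i].
  elim/depth_ind: y => y IHy ay; have yr := col_neq_root ca ay ir.
  case: (a (par y) =P Some i) => apy; last first.
    exists [:: par y; y]; split=> //.
    - by rewrite /is_path /= edge_par.
    - by move=> z; rewrite inE => /eqP->.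
  have [s [ps se sc ss]] := IHy yr apy; exists (rcons s y).
  have [y0 [y1 [t [sE _]]]] := is_pathP ps; split.
  - move: ps; rewrite /is_path size_rcons => /andP[s2 st]; apply/andP; split.
      exact: leqW.
    move: st se; rewrite sE /path_end /= => /andP[-> pt] lt.
    by rewrite rcons_path pt /= lt edge_par.
  - by rewrite /path_end last_rcons.
  - move=> z; rewrite sE /= -rcons_cons mem_rcons inE => /orP[/eqP->//|zt].
    by apply: sc; rewrite sE.
  - by move: ss; rewrite sE.
(* Built from a deepest vertex of the class, this path contains the whole class, since by [col_sib]
   no vertex of the class branches off. *)
case: (@arg_maxnP T x (fun z => a z == Some i) (@depth R T)) => [|e /eqP ae emax].
  exact/eqP.
have [s [ps se sc ss]] := build e ae; exists s; split=> // z; split; first exact: sc.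
elim/depth_ind: z => z IHz az; have zr := col_neq_root ca az ir.
case: (a (par z) =P Some i) => apz; last first.
  have [t ts pt] := path_top ps; have at_ := sc t ts.
  have tr := col_neq_root ca at_ ir.
  by rewrite (col_top ca zr tr az at_ apz) // pt.
have pzs := IHz zr apz; have [_ pzs' _ _] := path_behead ps pzs.
have pze : par z <> path_end s.
  rewrite se => pze; have /emax : a z == Some i by exact/eqP.
  by rewrite /= /geq /= leqNgt (depth_par zr) pze ltnSn.
have [z' z's pz'] := path_next ps pzs' pze; have az' := sc z' z's.
have [<-//|zz'] := eqVneq z' z.
have z'r := col_neq_root ca az' ir.
by rewrite (col_sib ca z'r zr zz' pz' az') ?pz' in az.
Qed.

Variables (U : pred J) (P : J -> seq T).
Hypothesis UP : forall i, U i <-> i != croot J /\ exists x, a x = Some i.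
Hypothesis PP : forall i, U i ->
  is_path (P i) /\ forall x, x \in behead (P i) <-> a x = Some i.

Lemma color_path_inj : {in U &, injective P}.
Proof.
move=> i j /PP[pi iP] /PP[_ jP] Pij.
have := path_end_mem pi => /[dup] /iP aei; rewrite Pij => /jP.
by rewrite -Pij aei => -[].
Qed.

(** Beyond their starts the paths are disjoint. Two common vertices would be the two starts, each
    lying on the other path beyond its start, which the depths forbid. *)
Lemma color_path_meet i j : U i -> U j -> i <> j ->
  (#|path_meet (P i) (P j)| <= 1)%N.
Proof.
move=> /PP[pi iP] /PP[pj jP] ij; rewrite leqNgt; apply/negP => /card_gt1P[x [y []]].
rewrite !inE => /andP[xi xj] /andP[yi yj] xy.
have one k z : U k -> z \in behead (P k) -> a z = Some k.
  by move=> /PP[_ kP] /kP.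
have disj z : z \in behead (P i) -> z \in behead (P j) -> False.
  by move=> /iP az /jP; rewrite az => -[].
case: (path_memE pi xi) (path_memE pi yi) (path_memE pj xj) (path_memE pj yj).
  move=> xE [yE|yi'] [xE'|xj'] [yE'|yj'].
  + by rewrite xE yE eqxx in xy.
  + by rewrite xE yE eqxx in xy.
  + by rewrite xE yE eqxx in xy.
  + by rewrite xE yE eqxx in xy.
  + by rewrite xE' yE' eqxx in xy.
  + exact: disj yi' yj'.
  + have := path_depth_start pi yi'; have := path_depth_start pj xj'.
    by rewrite -xE -yE' => lt1 /(ltn_trans lt1); rewrite ltnn.
  + exact: disj yi' yj'.
move=> xi' [yE|yi'] [xE'|xj'] [yE'|yj']; try by [exact: disj xi' xj'|exact: disj yi' yj'].
- by rewrite xE' yE' eqxx in xy.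
- have := path_depth_start pi xi'; have := path_depth_start pj yj'.
  by rewrite -yE -xE' => lt1 /(ltn_trans lt1); rewrite ltnn.
- by rewrite xE' yE' eqxx in xy.
Qed.

Lemma color_path_start i : U i -> a (path_start (P i)) = Some (cpar i).
Proof.
move=> /[dup] /UP[ir _] /PP[pi iP]; have [t ti pt] := path_top pi.
have at_ := (iP t).1 ti; rewrite -pt.
case: (col_par ca (col_neq_root ca at_ ir) at_) => // /iP.
by rewrite pt (negbTE (path_startN pi)).
Qed.

(** If path [cpar i] went on beyond the start of path [i], then [col_sib] would leave the first edge
    of path [i] uncolored. *)
Lemma color_path_start_end i : U i -> cpar i != croot J ->
  U (cpar i) /\ path_start (P i) = path_end (P (cpar i)).
Proof.
move=> ui pr; have as_ := color_path_start ui.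
have uj : U (cpar i) by apply/UP; split=> //; exists (path_start (P i)).
split=> //; have [pj jP] := PP uj; have [pi iP] := PP ui.
have [//|/eqP se] := eqVneq (path_start (P i)) (path_end (P (cpar i))).
have [_ sj _ _] := path_behead pj ((jP _).2 as_).
have [z zj pz] := path_next pj sj se; have [t ti pt] := path_top pi.
have [ir _] := (UP i).1 ui.
have at_ := (iP t).1 ti; have az := (jP z).1 zj.
have tr := col_neq_root ca at_ ir; have zr := col_neq_root ca az pr.
have zt : z != t.
  apply/eqP => zt; move: az; rewrite zt at_ => -[ij].
  by have := cpar_neq ir; rewrite -ij eqxx.
by rewrite (col_sib ca zr tr zt _ az) ?pz ?pt // in at_.
Qed.

Lemma color_path_start_root i : U i -> cpar i = croot J ->
  path_start (P i) = troot T.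
Proof. by move=> ui pr; apply: (col_rootP ca); rewrite -pr color_path_start. Qed.

Lemma color_path_label i : U i -> path_label (P i) = weight (@wt R T) a (Some i).
Proof.
move=> /PP[pi iP]; rewrite path_labelE // /weight; apply: eq_bigl => x.
by apply/idP/eqP => /iP.
Qed.

Lemma color_path_unmapped (Q : pred (T * T)) :
  (forall e, Q e <-> forall i, U i -> e \notin path_edges (P i)) ->
  \sum_(e in [set e : T * T | edge e.1 e.2 & Q e]%SET) label e =
  weight (@wt R T) a None.
Proof.
move=> QP; rewrite (sum_edges Q) /weight; apply: eq_bigl => x.
apply/andP/eqP => [[xr /QP xN]|ax].
  case ax: (a x) => [i|] //.
  have ui : U i by apply/UP; split; [exact: col_neq_croot ca ax xr|exists x].
  have [pi iP] := PP ui; have /negP[] := xN i ui.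
  by rewrite path_edgesE //; apply/mapP; exists x => //; apply/iP.
split; first by apply: contra_eq_neq ax => ->; rewrite (col_root ca).
apply/QP => i /PP[pi iP]; rewrite path_edgesE //.
by apply/mapP => -[y /iP ay [xy _]]; rewrite -xy ax in ay.
Qed.

End ColorPaths.

(** * Conversion between matchings and path mappings *)

Section Conversion.
Variables (R : realType) (T1 T2 : merge_tree R).

Lemma matching_path_mapping (J : color_tree) (a : T1 -> option J)
    (b : T2 -> option J) :
  matching a b ->
  exists M : {fset seq T1 * seq T2}, path_mapping M /\ mapping_cost M <= mcost a b.
Proof.
(* The root color stands for no path and is left out. *)
move=> [ca cb ab]; pose U i := (i != croot J) && [exists x, a x == Some i].
have UaP i : U i <-> i != croot J /\ exists x, a x = Some i.
  by split=> [/andP[ir /existsP[x /eqP ax]]|[ir [x ax]]]; [split=> //; exists x|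
    apply/andP; split=> //; apply/existsP; exists x; exact/eqP].
have UbP i : U i <-> i != croot J /\ exists x, b x = Some i by rewrite UaP ab.
have /boolp.choice[P PP] i : exists s, U i ->
    is_path s /\ forall x, x \in behead s <-> a x = Some i.
  case: (boolP (U i)) => [|_]; last by exists [::].
  by move=> /UaP[ir /(color_path ca ir)[s sP]]; exists s.
have /boolp.choice[Q QP] i : exists s, U i ->
    is_path s /\ forall x, x \in behead s <-> b x = Some i.
  case: (boolP (U i)) => [|_]; last by exists [::].
  by move=> /UbP[ir /(color_path cb ir)[s sP]]; exists s.
have P_inj := color_path_inj PP; have Q_inj := color_path_inj QP.
pose s := [seq (P i, Q i) | i <- enum U]; pose M := seq_fset tt s.
have MP p q : (p, q) \in M <-> exists i, [/\ U i, p = P i & q = Q i].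
  rewrite seq_fsetE; split=> [/mapP[i]|[i [ui -> ->]]].
    by rewrite mem_enum => ui [-> ->]; exists i.
  by apply/mapP; exists i; rewrite ?mem_enum.
have allP e (c : seq T1 * seq T2 -> bool) :
  all c M <-> forall i, U i -> c (P i, Q i).
  split=> [/allP cM i ui|cM]; first by apply: cM; apply/MP; exists i.
  by apply/allP => -[p q] /MP[i [ui -> ->]]; exact: cM.
have us : uniq s.
  by rewrite map_inj_in_uniq ?enum_uniq // => i j; rewrite !mem_enum => ui uj [/P_inj->].
exists M; split.
  split.
  - by move=> p q /MP[i [ui -> ->]]; have [] := PP i ui; have [] := QP i ui.
  - move=> p1 q1 p2 q2 /MP[i [ui -> ->]] /MP[j [uj -> ->]].
    by split=> [/P_inj|/Q_inj] ->.
  - move=> p1 q1 p2 q2 /MP[i [ui -> ->]] /MP[j [uj -> ->]] ij.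
    have {}ij : i <> j by move=> E; apply: ij; rewrite E.
    by split; [exact: (color_path_meet PP)|exact: (color_path_meet QP)].
  - move=> p q /MP[i [ui -> ->]]; have [pr|pr] := eqVneq (cpar i) (croot J).
      by right; split; [exact: (color_path_start_root ca UaP PP)|
        exact: (color_path_start_root cb UbP QP)].
    have [uj sP] := color_path_start_end ca UaP PP ui pr.
    have [_ sQ] := color_path_start_end cb UbP QP ui pr.
    by left; exists (P (cpar i)), (Q (cpar i)); split=> //; apply/MP; exists (cpar i).
rewrite /mapping_cost /unmapped1 /unmapped2 /ccost.
rewrite (color_path_unmapped ca UaP PP); last by move=> e; rewrite allP.
rewrite (color_path_unmapped cb UbP QP); last by move=> e; rewrite allP.
rewrite !lerD2r (perm_big _ (seq_fset_perm tt s)) /= undup_id // big_map.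
(* Colors outside [U] contribute only nonnegative terms. *)
rewrite big_enum /= [leRHS](bigID U) /= -[leLHS]addr0; apply: lerD; last exact: sumr_ge0.
apply: ler_sum => i ui.
by rewrite (color_path_label PP ui) (color_path_label QP ui).
Qed.

(** The pairs in [M] themselves serve as colors, together with a root color; a nonempty [M] provides
    a mapped edge. *)
Lemma path_mapping_matching (M : {fset seq T1 * seq T2}) :
  path_mapping M -> M != fset0 ->
  exists (J : color_tree) (a : T1 -> option J) (b : T2 -> option J),
    [/\ matching a b, colored a & mcost a b = mapping_cost M].
Proof.
move=> [Mpath Minj Mmeet Mstart] M0.
pose P (i : M) := (val i).1; pose Q (i : M) := (val i).2.
have iM (i : M) : (P i, Q i) \in M by rewrite -surjective_pairing; exact: valP.
have pP i : is_path (P i) by have [] := Mpath _ _ (iM i).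
have pQ i : is_path (Q i) by have [] := Mpath _ _ (iM i).
have ijM (i j : M) : i <> j -> (P i, Q i) <> (P j, Q j).
  by move=> ij; rewrite -!surjective_pairing => /val_inj.
have mP i j : i <> j -> (#|path_meet (P i) (P j)| <= 1)%N.
  by move=> /ijM ij; have [] := Mmeet _ _ _ _ (iM i) (iM j) ij.
have mQ i j : i <> j -> (#|path_meet (Q i) (Q j)| <= 1)%N.
  by move=> /ijM ij; have [] := Mmeet _ _ _ _ (iM i) (iM j) ij.
(* The third condition on path mappings provides the parent colors, [None] meaning that both paths
   start at the roots. *)
have /boolp.choice[pi piP] (i : M) : exists o : option M,
    path_start (P i) = (if o is Some j then path_end (P j) else troot T1) /\
    path_start (Q i) = (if o is Some j then path_end (Q j) else troot T2).
  case: (Mstart _ _ (iM i)) => [[p [q [pq sp sq]]]|[sp sq]]; last by exists None.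
  by exists (Some [` pq]%fset).
have sP i := (piP i).1; have sQ i := (piP i).2.
(* A path starts where its predecessor ends, so the depth of its end in [T1] is a valid rank. *)
pose rk (o : option M) := if o is Some i then depth (path_end (P i)) else 0%N.
have rkP i : i != None -> (rk (obind pi i) < rk i)%N.
  case: i => // i _ /=; have := path_depth_start (pP i) (path_end_mem (pP i)).
  by rewrite sP /rk; case: (pi i) => // /(leq_trans _)->.
pose a := family_color P rkP; pose b := family_color Q rkP.
have endP i : a (path_end (P i)) = Some (Some i).
  by apply/(family_colorP rkP pP mP); exact: path_end_mem.
have endQ i : b (path_end (Q i)) = Some (Some i).
  by apply/(family_colorP rkP pQ mQ); exact: path_end_mem.
exists (family_tree rkP), a, b; split.
- split; [exact: coloring_family|exact: coloring_family|].
  move=> [i|]; split=> _; [by exists (path_end (Q i))|by exists (path_end (P i))| |].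
    by exists (troot T2); apply/family_color_root.
  by exists (troot T1); apply/family_color_root.
- have /fset0Pn[pq pqM] := M0; pose i : M := [` pqM]%fset.
  exists (path_end (P i)); last by rewrite endP.
  by have [] := path_behead (pP i) (path_end_mem (pP i)).
rewrite /ccost /mapping_cost; congr (_ + _ + _).
- rewrite big_seq_fsetE (bigD1 None) //= !weight_family_root // subrr normr0 add0r.
  rewrite (reindex_omap Some id) /=; last by case.
  rewrite (eq_bigl xpredT) => [|i]; last by rewrite eqxx.
  by apply: eq_bigr => i _; rewrite !weight_family.
- rewrite (weight_family_None rkP pP mP); apply: eq_bigl => e; rewrite !inE.
  congr (_ && _); apply/forallP/allP => [eN pq pqM|eN i]; last exact: eN (val i) (valP i).
  exact: (eN [` pqM]%fset).
- rewrite (weight_family_None rkP pQ mQ); apply: eq_bigl => e; rewrite !inE.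
  congr (_ && _); apply/forallP/allP => [eN pq pqM|eN i]; last exact: eN (val i) (valP i).
  exact: (eN [` pqM]%fset).
Qed.

End Conversion.

(** * Existence of a nonempty optimal path mapping *)

Section Optimum.
Variable R : realType.

Lemma seq_argmin (X : eqType) (P : X -> Prop) (c : X -> R) (s : seq X) x :
  x \in s -> P x -> exists2 x, P x & forall y, y \in s -> P y -> c x <= c y.
Proof.
move=> xs Px.
suff [y Py ymin] : exists2 y, P y & forall z, z \in x :: s -> P z -> c y <= c z.
  by exists y => // z zs; apply: ymin; rewrite inE zs orbT.
elim: s {xs} => [|z s [y Py ymin]].
  by exists x => // z; rewrite inE => /eqP->.
have [[Pz zy]|Nz] := pselect (P z /\ c z <= c y).
  exists z => // t; rewrite inE => /orP[tx|]; last first.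
    rewrite inE => /orP[/eqP->//|ts] Pt; apply: (le_trans zy); apply: ymin => //.
    by rewrite inE ts orbT.
  by move=> Pt; apply: (le_trans zy); apply: ymin; rewrite // inE tx.
exists y => // t; rewrite !inE orbCA => /orP[/eqP-> Pz|]; last exact: ymin.
by case: (leP (c y) (c z)) => // /ltW zy; case: Nz.
Qed.

Variables T1 T2 : merge_tree R.

Lemma path_size (T : merge_tree R) (s : seq T) : is_path s -> (size s <= #|T|)%N.
Proof. by move=> /path_uniq/card_uniqP <-; exact: max_card. Qed.

(** Paths repeat no vertex, so their lengths are bounded and all path mappings are subsets of one
    finite set. *)
Lemma path_mappings_finite : exists X : seq {fset seq T1 * seq T2},
  forall M, path_mapping M -> M \in X.
Proof.
pose U : {fset seq T1 * seq T2} :=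
  seq_fset tt [seq (bseqval x.1, bseqval x.2) | x : #|T1|.-bseq T1 * #|T2|.-bseq T2].
exists (fpowerset U) => M [Mpath _ _ _]; rewrite fpowersetE.
apply/fsubsetP => -[p q] /Mpath[/path_size sp /path_size sq].
rewrite seq_fsetE; apply/mapP; exists (Bseq sp, Bseq sq) => //.
by rewrite mem_enum.
Qed.

Lemma path_mapping_fset0 : path_mapping (fset0 : {fset seq T1 * seq T2}).
Proof. by split=> p q; rewrite ?in_fset0. Qed.

(** The empty mapping cannot be turned directly into an edit sequence, as root edges cannot be
    deleted. Pairing the two root edges is no more expensive: two positive labels differ by at most
    their sum. *)
Lemma root_edge_mapping : exists M : {fset seq T1 * seq T2},
  [/\ path_mapping M, M != fset0 &
      mapping_cost M <= mapping_cost (fset0 : {fset seq T1 * seq T2})].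
Proof.
have root_path (T : merge_tree R) : exists2 c : T, is_path [:: troot T; c] & c != troot T.
  have [c cr cP] := root_childP T; exists c => //.
  have [x [xr px]] : exists x : T, x != troot T /\ par x = troot T.
    elim/depth_ind: {cP} c cr => c IHc cr.
    by have [pc|/IHc] := eqVneq (par c) (troot T); [exists c|apply].
  by rewrite /is_path /= -(cP x xr px) -px edge_par.
have [c1 p1 c1r] := root_path T1; have [c2 p2 c2r] := root_path T2.
set P := [:: troot T1; c1]; set Q := [:: troot T2; c2].
exists [fset (P, Q)]%fset; split.
- split.
  + by move=> p q /fset1P[-> ->].
  + by move=> p q p' q' /fset1P[-> ->] /fset1P[-> ->].
  + by move=> p q p' q' /fset1P[-> ->] /fset1P[-> ->] [].
  + by move=> p q /fset1P[-> ->]; right.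
- by apply/fset0Pn; exists (P, Q); rewrite in_fset1.
(* Compared with the empty mapping, exactly the edge above [c] ceases to be unmapped. *)
have drop (T : merge_tree R) (c : T) (s t : pred (T * T)) :
    is_path [:: troot T; c] -> c != troot T -> (forall e, s e = (e != (c, par c))) ->
    (forall e, t e) ->
    \sum_(e in [set e : T * T | edge e.1 e.2 & t e]%SET) label e =
    wt c + \sum_(e in [set e : T * T | edge e.1 e.2 & s e]%SET) label e.
  move=> pc cr sE tE; rewrite (sum_edges t) (sum_edges s) (bigD1 c) /=; last by rewrite cr tE.
  congr (_ + _); apply: eq_bigl => x; rewrite tE andbT sE xpair_eqE.
  by case: (eqVneq x c) => [->|_]; rewrite ?eqxx ?andbT.
have sE (T : merge_tree R) (c : T) e : is_path [:: troot T; c] ->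
    (e \notin path_edges [:: troot T; c]) = (e != (c, par c)).
  by move=> /path_edgesE->; rewrite /= inE.
have pl (T : merge_tree R) (c : T) : is_path [:: troot T; c] ->
    path_label [:: troot T; c] = wt c.
  by move=> pc; rewrite path_labelE // (big_pred1 c) // => x; rewrite inE.
rewrite /mapping_cost big_seq_fset1 big_seq_fset0 add0r /= !pl // /unmapped1 /unmapped2.
rewrite (drop T1 c1 (fun e => all (fun pq => e \notin path_edges pq.1) [fset (P, Q)]%fset)
  (fun e => all (fun pq => e \notin path_edges pq.1) fset0)) //; last first.
  by move=> e; rewrite -sE //; apply/allP/idP => [/(_ (P, Q) (fset11 _))//|eN pq /fset1P->].
rewrite (drop T2 c2 (fun e => all (fun pq => e \notin path_edges pq.2) [fset (P, Q)]%fset)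
  (fun e => all (fun pq => e \notin path_edges pq.2) fset0)) //; last first.
  by move=> e; rewrite -sE //; apply/allP/idP => [/(_ (P, Q) (fset11 _))//|eN pq /fset1P->].
have := ler_normB (wt c1) (wt c2).
rewrite !(ger0_norm (wt_ge0 _)); lra.
Qed.

End Optimum.

Theorem theorem3 (R : realType) (T1 T2 : merge_tree R) :
  exists M : {fset seq T1 * seq T2},
    [/\ path_mapping M,
        forall M' : {fset seq T1 * seq T2},
          path_mapping M' -> mapping_cost M <= mapping_cost M' &
        delta1 T1 T2 = (mapping_cost M)%:E].
Proof.
have [X XP] := path_mappings_finite T1 T2.
have pm0 := @path_mapping_fset0 R T1 T2.
have [M0 pM0 M0min] :=
  seq_argmin (P := @path_mapping R T1 T2) (@mapping_cost R T1 T2) (XP _ pm0) pm0.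
(* The minimum is attained by a nonempty mapping, from which an edit sequence can be built. *)
have [M [pM Mn0 Mmin]] : exists M : {fset seq T1 * seq T2},
    [/\ path_mapping M, M != fset0 &
        forall M' : {fset seq T1 * seq T2},
          path_mapping M' -> mapping_cost M <= mapping_cost M'].
  have M0le (M' : {fset seq T1 * seq T2}) :
      path_mapping M' -> mapping_cost M0 <= mapping_cost M'.
    by move=> pM'; exact: M0min (XP _ pM') pM'.
  have [M0E|M0n] := eqVneq M0 fset0; last by exists M0.
  have [M [pM Mn le]] := root_edge_mapping T1 T2; exists M; split=> // M' pM'.
  by apply: (le_trans le); rewrite -M0E; exact: M0le.
exists M; split=> //; apply/eqP; rewrite eq_le; apply/andP; split.
  have [J [a [b [mab col <-]]]] := path_mapping_matching pM Mn0.
  have [S leS] := matching_edit_sequence mab col.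
  apply: (@le_trans _ _ (seq_cost S)%:E); last by rewrite lee_fin.
  by apply: ereal_inf_lbound; exists S.
(* Conversely, every edit sequence yields a matching and then a path mapping of at most its cost,
   which [M] does not exceed. *)
apply: le_ereal_inf_tmp => _ [S ->]; rewrite lee_fin.
have [J [a [b [mab leS]]]] := edit_sequence_matching S.
have [M' [pM' leM']] := matching_path_mapping mab.
exact: le_trans (Mmin _ pM') (le_trans leM' leS).
Qed.
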